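(* Let $B$ be an algebra, $P_0$ a projective $B$-module and $A=B[P_0]$. Let $(T,P)$ and $(T',P')$ be basic support $\tau$-tilting pairs for $\mathrm{mod}\,A$ such that there exists an arrow $(T,P)\to(T',P')$ in $Q(\mathrm{s}\tau\text{-}\mathrm{tilt}\,A)$. If $(T,P)=e(M,Q)$ for some $(M,Q)\in\mathrm{s}\tau\text{-}\mathrm{tilt}\,B$ and $\mathrm{Hom}_A(\mathcal{E}M,S)\neq0$, then there exists a support $\tau$-tilting pair $(N,R)$ in $\mathrm{s}\tau\text{-}\mathrm{tilt}\,B$ such that $(T',P')=e(N,R)$.
   Context: All algebras are basic connected finite dimensional algebras over an algebraically closed field $k$; $\mathrm{mod}\,C$ is the category of finitely generated left $C$-modules. The one-point extension of $B$ by $P_0$ is $A=B[P_0]=\begin{pmatrix} B & P_0\\ 0 & k\end{pmatrix}$. There is a unique indecomposable projective $A$-module $\widetilde P$ which is not a projective $B$-module, and $S$ is its simple top. $\mathrm{mod}\,B$ is regarded as embedded in $\mathrm{mod}\,A$ in the usual way (via the projection $A\to B$); projective $B$-modules are then projective $A$-modules. Let $U=e_BA$ with $e_B$ the identity of $B$, a $B$-$A$-bimodule; $\mathcal{E}=\mathrm{Hom}_B(U,-):\mathrm{mod}\,B\to\mathrm{mod}\,A$. For an algebra $C$, $|M|$ is the number of pairwise non-isomorphic indecomposable direct summands of $M$. A $C$-module $M$ is $\tau$-rigid if $\mathrm{Hom}_C(M,\tau_C M)=0$. A pair $(M,P)$ with $P$ a projective $C$-module is a support $\tau$-tilting pair (almost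 complete support $\tau$-tilting pair) if $M$ is $\tau$-rigid, $\mathrm{Hom}_C(P,M)=0$ and $|M|+|P|=|C|$ (resp. $|C|-1$). $\mathrm{s}\tau\text{-}\mathrm{tilt}\,C$ is the set of isomorphism classes of basic support $\tau$-tilting pairs (equivalently, basic support $\tau$-tilting modules), partially ordered by $(M,P)\le(T,Q)$ iff $\mathrm{Fac}\,M\subseteq\mathrm{Fac}\,T$, where $\mathrm{Fac}\,X$ is the class of factor modules of finite direct sums of copies of $X$. Each basic almost complete support $\tau$-tilting pair is a direct summand of exactly two basic support $\tau$-tilting pairs, called mutations of each other. The quiver $Q(\mathrm{s}\tau\text{-}\mathrm{tilt}\,C)$ has vertex set $\mathrm{s}\tau\text{-}\mathrm{tilt}\,C$ and an arrow $x\to y$ iff $x,y$ are mutations of each other and $x>y$; it is the Hasse quiver of the poset. The map $e:\mathrm{s}\tau\text{-}\mathrm{tilt}\,B\to\mathrm{s}\tau\text{-}\mathrm{tilt}\,A$ is $e(M,Q)=(\mathcal{E}M\oplus S,Q)$ (well defined). *)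

(* Defs.v *)
From HB Require Import structures.
From mathcomp Require Import all_boot all_algebra all_field.
From mathcomp Require Import boolp.

Set Implicit Arguments.
Unset Strict Implicit.
Unset Printing Implicit Defensive.

Import GRing.Theory.
Local Open Scope ring_scope.

(* Modules over an algebra C are left modules in the sense of [lmodType C];
   right C-modules are left modules over the converse ring [C^c]. *)

Section HomGroup.
Context (R : nzRingType) (X Y : lmodType R).

Definition Hom := {linear X -> Y}.

Lemma HomP (f g : Hom) : (forall x, f x = g x) -> f = g.
Proof.
case: f => f [[f1] [f2]]; case: g => g [[g1] [g2]] /= /funext fg.
by subst g; rewrite (Prop_irrelevance f1 g1) (Prop_irrelevance f2 g2).
Qed.

HB.instance Definition _ := gen_eqMixin Hom.
HB.instance Definition _ := gen_choiceMixin Hom.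

Definition hom0 : Hom := \0.
Definition homN (f : Hom) : Hom :=  \- f.
Definition homD (f g : Hom) : Hom := f \+ g.

Fact hom_addA : associative homD.
Proof. by move=> f g h; apply: HomP => x /=; rewrite addrA. Qed.
Fact hom_addC : commutative homD.
Proof. by move=> f g; apply: HomP => x /=; rewrite addrC. Qed.
Fact hom_add0 : left_id hom0 homD.
Proof. by move=> f; apply: HomP => x /=; rewrite add0r. Qed.
Fact hom_addN : left_inverse hom0 homN homD.
Proof. by move=> f; apply: HomP => x /=; rewrite addNr. Qed.

HB.instance Definition _ :=
  GRing.isZmodule.Build Hom hom_addA hom_addC hom_add0 hom_addN.
End HomGroup.

Definition restr (R S : nzRingType) (phi : {rmorphism R -> S})
  (X : lmodType S) : Type := X.

Section Restriction.
Context (R S : nzRingType) (phi : {rmorphism R -> S}) (X : lmodType S).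

HB.instance Definition _ := GRing.Zmodule.on (restr phi X).

Definition restr_scale (a : R) (x : restr phi X) : restr phi X :=
  phi a *: (x : X).

Fact restr_scaleA a b x :
  restr_scale a (restr_scale b x) = restr_scale (a * b) x.
Proof. by rewrite /restr_scale scalerA rmorphM. Qed.
Fact restr_scale1 : left_id 1 restr_scale.
Proof. by move=> x; rewrite /restr_scale rmorph1 scale1r. Qed.
Fact restr_scaleDr : right_distributive restr_scale +%R.
Proof. by move=> a x y; rewrite /restr_scale scalerDr. Qed.
Fact restr_scaleDl x : {morph restr_scale^~ x : a b / a + b}.
Proof. by move=> a b; rewrite /restr_scale rmorphD scalerDl. Qed.

HB.instance Definition _ := GRing.Zmodule_isLmodule.Build R (restr phi X)
  restr_scaleA restr_scale1 restr_scaleDr restr_scaleDl.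
End Restriction.

Section Modules.
Context (C : nzRingType).
Implicit Types (M N P X Y : lmodType C).

Definition surj M N (f : {linear M -> N}) := forall y, exists x, f x = y.

Definition iso M N := exists f : {linear M -> N}, bijective f.

Definition hom_nonzero M N := exists (f : {linear M -> N}) (x : M), f x != 0.

Definition fingen M := exists s : seq M, forall x : M,
  exists c : 'I_(size s) -> C, x = \sum_(i < size s) c i *: s`_i.

Definition projective P :=
  forall X Y (g : {linear X -> Y}) (f : {linear P -> Y}), surj g ->
  exists h : {linear P -> X}, forall x, g (h x) = f x.

(* The projective objects of the category mod C. *)
Definition proj P := fingen P /\ projective P.

Definition summand X M := exists Y, iso M (X * Y)%type.

Definition nonzero M := exists x : M, x != 0.

Definition indecomposable M :=
  nonzero M /\ forall X Y, iso M (X * Y)%type -> ~ (nonzero X /\ nonzero Y).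

(* [card_ind M n] reads |M| = n. *)
Definition card_ind M n := exists X : 'I_n -> lmodType C,
  [/\ forall i, indecomposable (X i) /\ summand (X i) M,
      forall i j, iso (X i) (X j) -> i = j
    & forall Y, indecomposable Y -> summand Y M -> exists i, iso Y (X i)].

(* No indecomposable occurs twice in a decomposition of M. *)
Definition basic M :=
  forall X, indecomposable X -> ~ summand (X * X)%type M.

Definition Fac M X :=
  exists (n : nat) (g : {linear {ffun 'I_n -> M} -> X}), surj g.

Definition maximal_sub M (W : {pred M}) :=
  [/\ submod_closed W, exists x, x \notin W
    & forall V : {pred M}, submod_closed V -> {subset W <= V} ->
        (forall x, x \in V) \/ {subset V <= W}].

(* S is isomorphic to top M = M / rad M, where rad M is the intersection of the
   maximal submodules of M. *)
Definition is_top M (S : lmodType C) := exists2 f : {linear M -> S}, surj f &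
  forall x, f x = 0 <-> forall W : {pred M}, maximal_sub W -> x \in W.

Definition superfluous M (K : M -> Prop) :=
  forall W : {pred M}, submod_closed W ->
  (forall x, exists w y, [/\ w \in W, K y & x = w + y]) -> forall x, x \in W.

(* P1 -f-> P0 -g-> M -> 0 is a minimal projective presentation: it is exact,
   and P0 -> M and P1 -> ker g are projective covers. *)
Definition min_proj_pres P1 P0 M (f : {linear P1 -> P0})
    (g : {linear P0 -> M}) :=
  [/\ proj P1 /\ proj P0, surj g,
      forall y, g y = 0 <-> exists x, f x = y,
      superfluous (fun y => g y = 0)
    & superfluous (fun x => f x = 0)].

End Modules.

(* The right C-module Hom_C(P, C). *)
Definition star (C : nzRingType) (P : lmodType C) : Type := Hom P C^o.

Section Star.
Context (C : nzRingType) (P : lmodType C).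

HB.instance Definition _ := GRing.Zmodule.on (star P).

Section Scale.
Variables (a : C^c) (h : star P).
Definition star_fun (x : P) : C^o := (h : Hom P C^o) x * (a : C).
Fact star_fun_linear : linear star_fun.
Proof. by move=> c x y; rewrite /star_fun linearP /= mulrDl -mulrA. Qed.
HB.instance Definition _ :=
  GRing.isLinear.Build C P C^o *:%R star_fun star_fun_linear.
Definition star_scale : star P := (star_fun : {linear P -> C^o}).
End Scale.

Fact star_scaleA a b h : star_scale a (star_scale b h) = star_scale (a * b) h.
Proof. by apply: HomP => x; rewrite /= /star_fun /= /star_fun -mulrA. Qed.
Fact star_scale1 : left_id 1 star_scale.
Proof. by move=> h; apply: HomP => x; rewrite /= /star_fun mulr1. Qed.
Fact star_scaleDr : right_distributive star_scale +%R.
Proof. by move=> a g h; apply: HomP => x; rewrite /= /star_fun mulrDl. Qed.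
Fact star_scaleDl h : {morph star_scale^~ h : a b / a + b}.
Proof. by move=> a b; apply: HomP => x; rewrite /= /star_fun mulrDr. Qed.

HB.instance Definition _ := GRing.Zmodule_isLmodule.Build C^c (star P)
  star_scaleA star_scale1 star_scaleDr star_scaleDl.
End Star.

Section Algebras.
Context (k : fieldType) (C : algType k).

Definition in_algc (c : k) : C^c := c%:A : C.
Fact in_algc_zmod : zmod_morphism in_algc.
Proof. by move=> a b; rewrite /in_algc scalerBl. Qed.
Fact in_algc_monoid : monoid_morphism in_algc.
Proof.
split; first by rewrite /in_algc scale1r.
move=> a b; rewrite /in_algc mulrC.
by rewrite [RHS]/GRing.mul /= -scalerAl mul1r scalerA.
Qed.
HB.instance Definition _ := GRing.isZmodMorphism.Build k C^c in_algc in_algc_zmod.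
HB.instance Definition _ :=
  GRing.isMonoidMorphism.Build k C^c in_algc in_algc_monoid.

(* The left C-module D X = Hom_k(X, k) of a right C-module X. *)
Definition dual (X : lmodType C^c) : Type :=
  Hom (restr in_algc X) k^o.
End Algebras.

Section Dual.
Context (k : fieldType) (C : algType k) (X : lmodType C^c).

HB.instance Definition _ := GRing.Zmodule.on (dual X).

Section Scale.
Variables (a : C) (phi : dual X).
Definition dual_fun (x : restr (@in_algc k C) X) : k^o :=
  (phi : Hom _ _) ((a : C^c) *: (x : X)).
Fact dual_fun_linear : linear dual_fun.
Proof.
move=> c x y; rewrite /dual_fun -[RHS](linearP (phi : Hom _ _)); congr (_ _).
rewrite scalerDr; congr (_ + _).
have ca : (a : C^c) * in_algc C c = in_algc C c * a.
  by rewrite /in_algc /GRing.mul /= -scalerAl mul1r -scalerAr mulr1.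
by rewrite [LHS](scalerA _ (in_algc C c) (x : X)) ca -scalerA.
Qed.
HB.instance Definition _ := GRing.isLinear.Build k (restr (@in_algc k C) X) k^o
  *:%R dual_fun dual_fun_linear.
Definition dual_scale : dual X := (dual_fun : {linear _ -> k^o}).
End Scale.

Fact dual_scaleA a b phi :
  dual_scale a (dual_scale b phi) = dual_scale (a * b) phi.
Proof. by apply: HomP => x; rewrite /= /dual_fun /= /dual_fun scalerA. Qed.
Fact dual_scale1 : left_id 1 dual_scale.
Proof. by move=> h; apply: HomP => x; rewrite /= /dual_fun scale1r. Qed.
Fact dual_scaleDr : right_distributive dual_scale +%R.
Proof. by move=> a g h; apply: HomP. Qed.
Fact dual_scaleDl phi : {morph dual_scale^~ phi : a b / a + b}.
Proof.
move=> a b; apply: HomP => x; rewrite /= /dual_fun scalerDl.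
exact: (raddfD (phi : Hom _ _)).
Qed.

HB.instance Definition _ := GRing.Zmodule_isLmodule.Build C (dual X)
  dual_scaleA dual_scale1 dual_scaleDr dual_scaleDl.
End Dual.

Section TauTilting.
Context (k : fieldType) (C : algType k).
Implicit Types (M N P T X : lmodType C).

(* [is_tr M X]: X is the transpose of M, i.e. the cokernel of
   Hom_C(f, C) : P0^* -> P1^* for a minimal projective presentation f of M. *)
Definition is_tr M (X : lmodType C^c) :=
  exists (P1 P0 : lmodType C) (f : {linear P1 -> P0}) (g : {linear P0 -> M}),
  min_proj_pres f g /\
  exists2 p : {linear star P1 -> X}, surj p &
    forall h : star P1, p h = 0 <->
      exists h' : star P0, forall x, (h : Hom _ _) x = (h' : Hom _ _) (f x).

(* [is_tau M N]: N is the Auslander-Reiten translate D Tr M. *)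
Definition is_tau M N := exists2 X, is_tr M X & iso N (dual X).

Definition tau_rigid M := exists2 N, is_tau M N & ~ hom_nonzero M N.

Definition modpair := (lmodType C * lmodType C)%type.
Implicit Types x y z : modpair.

Definition pair_iso x y := iso x.1 y.1 /\ iso x.2 y.2.
Definition pair_summand x y := summand x.1 y.1 /\ summand x.2 y.2.
Definition pair_basic x := basic x.1 /\ basic x.2.

Definition rigid_pair x :=
  [/\ fingen x.1 /\ proj x.2, tau_rigid x.1 & ~ hom_nonzero x.2 x.1].

Definition support_tau_tilting x := rigid_pair x /\
  exists m p, [/\ card_ind x.1 m, card_ind x.2 p & card_ind C^o (m + p)].

Definition almost_support_tau_tilting x := rigid_pair x /\
  exists m p, [/\ card_ind x.1 m, card_ind x.2 p & card_ind C^o (m + p).+1].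

(* Representatives of the elements of the poset; equality there is [pair_iso]. *)
Definition in_stau_tilt x := support_tau_tilting x /\ pair_basic x.

Definition le_pair x y := forall X, Fac x.1 X -> Fac y.1 X.

Definition mutation x y :=
  [/\ in_stau_tilt x, in_stau_tilt y, ~ pair_iso x y
    & exists z, [/\ almost_support_tau_tilting z, pair_basic z,
                    pair_summand z x & pair_summand z y]].

Definition arrow x y := [/\ mutation x y, le_pair y x & ~ pair_iso y x].

Definition basic_alg := basic C^o.

Definition connected_alg :=
  forall e : C, e * e = e -> (forall a, e * a = a * e) -> e = 0 \/ e = 1.
End TauTilting.

(* The triple (b, p, c) stands for the matrix with rows (b p) and (0 c); k acts
   on the right of P0 through k -> B. *)
Definition onept (k : fieldType) (B : algType k) (P0 : lmodType B) : Type :=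
  (B * restr (in_alg B) P0 * k^o)%type.

Section OnePoint.
Context (k : fieldType) (B : algType k) (P0 : lmodType B).
Notation A := (onept P0).

HB.instance Definition _ := GRing.Lmodule.on A.

Definition o_b (a : A) : B := a.1.1.
Definition o_p (a : A) : P0 := a.1.2.
Definition o_c (a : A) : k := a.2.
Definition Onept (b : B) (p : P0) (c : k) : A := (b, p, c).

Definition o_one : A := Onept 1 0 1.
Definition o_mul (x y : A) : A :=
  Onept (o_b x * o_b y) (o_b x *: o_p y + (o_c y)%:A *: o_p x) (o_c x * o_c y).

Lemma o_eq (x y : A) : o_b x = o_b y -> o_p x = o_p y -> o_c x = o_c y -> x = y.
Proof.
by case: x => [[? ?] ?]; case: y => [[? ?] ?]; rewrite /o_b /o_p /o_c /= => -> -> ->.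
Qed.

Fact alg_comm (c : k) (b : B) : b * c%:A = c%:A * b.
Proof. by rewrite -scalerAl -scalerAr mul1r mulr1. Qed.

Fact o_mulA : associative o_mul.
Proof.
move=> x y z; apply: o_eq; rewrite /o_mul /o_b /o_p /o_c /= ?mulrA //.
rewrite !scalerDr !scalerA -addrA; congr (_ + (_ + _ *: _)).
  by rewrite alg_comm.
by rewrite -scalerAl mul1r scalerA mulrC.
Qed.
Fact o_mul1 : left_id o_one o_mul.
Proof.
move=> x; apply: o_eq; rewrite /o_mul /o_b /o_p /o_c /= ?mul1r //.
by rewrite scale1r scaler0 addr0.
Qed.
Fact o_mulr1 : right_id o_one o_mul.
Proof.
move=> x; apply: o_eq; rewrite /o_mul /o_b /o_p /o_c /= ?mulr1 //.
by rewrite scaler0 !scale1r add0r.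
Qed.
Fact o_mulDl : left_distributive o_mul +%R.
Proof.
move=> x y z; apply: o_eq; rewrite /o_mul /o_b /o_p /o_c /= ?mulrDl //.
by rewrite scalerDl scalerDr addrACA.
Qed.
Fact o_mulDr : right_distributive o_mul +%R.
Proof.
move=> x y z; apply: o_eq; rewrite /o_mul /o_b /o_p /o_c /= ?mulrDr //.
by rewrite scalerDr !scalerDl addrACA.
Qed.
Fact o_one_neq0 : o_one != 0.
Proof. by apply/eqP => /(congr1 o_c) /eqP; rewrite oner_eq0. Qed.

HB.instance Definition _ := GRing.Zmodule_isNzRing.Build A
  o_mulA o_mul1 o_mulr1 o_mulDl o_mulDr o_one_neq0.

Fact o_pM (x y : A) :
  o_p (x * y) = o_b x *: o_p y + (o_c y)%:A *: o_p x.
Proof. by []. Qed.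
Fact o_pZ (c : k) (x : A) : o_p (c *: x) = c%:A *: o_p x. Proof. by []. Qed.
Fact o_bZ (c : k) (x : A) : o_b (c *: x) = c *: o_b x. Proof. by []. Qed.
Fact o_cZ (c : k) (x : A) : o_c (c *: x) = c * o_c x. Proof. by []. Qed.

Fact o_scaleAl (c : k) (x y : A) : c *: (x * y) = (c *: x) * y.
Proof.
apply: o_eq; first exact: scalerAl; last exact: mulrA.
rewrite o_pZ !o_pM o_pZ o_bZ scalerDr !scalerA; congr (_ *: _ + _ *: _).
  by rewrite -scalerAl mul1r.
by rewrite alg_comm.
Qed.
HB.instance Definition _ := GRing.Lmodule_isLalgebra.Build k A o_scaleAl.

Fact o_scaleAr (c : k) (x y : A) : c *: (x * y) = x * (c *: y).
Proof.
apply: o_eq; first exact: scalerAr; last exact: mulrCA.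
rewrite o_pZ !o_pM o_pZ o_cZ scalerDr !scalerA; congr (_ *: _ + _ *: _).
  by rewrite alg_comm.
by rewrite -scalerAl mul1r scalerA.
Qed.
HB.instance Definition _ := GRing.Lalgebra_isAlgebra.Build k A o_scaleAr.

Fact o_b_zmod : zmod_morphism o_b. Proof. by []. Qed.
Fact o_b_monoid : monoid_morphism o_b. Proof. by []. Qed.
HB.instance Definition _ := GRing.isZmodMorphism.Build A B o_b o_b_zmod.
HB.instance Definition _ := GRing.isMonoidMorphism.Build A B o_b o_b_monoid.

(* The embedding of mod B into mod A. *)
Definition infl (M : lmodType B) : lmodType A := restr o_b M.

(* U = e_B A consists of the matrices with zero second row (see [rowU_actE]). *)
Definition rowU : lmodType B := (B^o * P0)%type.

Definition rowU_act (u : rowU) (a : A) : rowU :=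
  (u.1 * o_b a, u.1 *: o_p a + (o_c a)%:A *: u.2).

Lemma rowU_actE (u : rowU) (a : A) :
  Onept u.1 u.2 0 * a = Onept (rowU_act u a).1 (rowU_act u a).2 0.
Proof. by apply: o_eq => //; exact: mul0r. Qed.

Lemma rowU_scaleE (u : rowU) (b : B) :
  Onept b 0 0 * Onept u.1 u.2 0 = Onept (b *: u).1 (b *: u).2 0.
Proof.
apply: o_eq => //; last by exact: mul0r.
by rewrite o_pM /= scaler0 addr0.
Qed.

(* The left A-module Hom_B(U, M), with (a f)(u) = f(u a). *)
Definition homU (M : lmodType B) : Type := Hom rowU M.
End OnePoint.

Section HomU.
Context (k : fieldType) (B : algType k) (P0 : lmodType B) (M : lmodType B).
Notation A := (onept P0).

HB.instance Definition _ := GRing.Zmodule.on (homU P0 M).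

Fact rowU_act_linear (a : A) : linear (fun u : rowU P0 => rowU_act u a).
Proof.
move=> c [u p] [v q]; rewrite /rowU_act /=; congr (_, _) => /=.
  by rewrite mulrDl -mulrA.
rewrite scalerDl !scalerDr !scalerA addrACA alg_comm.
by congr (_ + _ + (_ + _)); rewrite scalerA.
Qed.

Section Scale.
Variables (a : A) (f : homU P0 M).
Definition homU_fun (u : rowU P0) : M := (f : Hom _ _) (rowU_act u a).
Fact homU_fun_linear : linear homU_fun.
Proof. by move=> c u v; rewrite /homU_fun rowU_act_linear linearP. Qed.
HB.instance Definition _ :=
  GRing.isLinear.Build B (rowU P0) M *:%R homU_fun homU_fun_linear.
Definition homU_scale : homU P0 M := (homU_fun : {linear _ -> M}).
End Scale.

Fact rowU_actA (u : rowU P0) (a b : A) :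
  rowU_act (rowU_act u a) b = rowU_act u (a * b).
Proof.
case: u => u p; rewrite /rowU_act /= /o_b /o_p /o_c /=; congr (_, _) => /=.
  by rewrite mulrA.
rewrite !scalerDr !scalerA -addrA; congr (_ + (_ + _ *: _)).
  by rewrite alg_comm.
by rewrite -scalerAl mul1r scalerA mulrC.
Qed.

Fact homU_scaleA a b f : homU_scale a (homU_scale b f) = homU_scale (a * b) f.
Proof. by apply: HomP => u; rewrite /= /homU_fun /= /homU_fun rowU_actA. Qed.
Fact homU_scale1 : left_id 1 homU_scale.
Proof.
move=> f; apply: HomP => -[u p]; rewrite /= /homU_fun /rowU_act /o_b /o_p /o_c /=.
by rewrite mulr1 scaler0 add0r !scale1r.
Qed.
Fact homU_scaleDr : right_distributive homU_scale +%R.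
Proof. by move=> a f g; apply: HomP. Qed.
Fact homU_scaleDl f : {morph homU_scale^~ f : a b / a + b}.
Proof.
move=> a b; apply: HomP => -[u p]; rewrite /= /homU_fun.
rewrite -(raddfD (f : Hom _ _)); congr (_ _).
rewrite /rowU_act /o_b /o_p /o_c /=; congr (_, _) => /=; first by rewrite mulrDr.
by rewrite scalerDr !scalerDl addrACA.
Qed.

HB.instance Definition _ := GRing.Zmodule_isLmodule.Build A (homU P0 M)
  homU_scaleA homU_scale1 homU_scaleDr homU_scaleDl.
End HomU.

Section EMap.
Context (k : fieldType) (B : algType k) (P0 : lmodType B).
Notation A := (onept P0).

Definition calE (M : lmodType B) : lmodType A := homU P0 M.

(* e(M, Q) = (E M (+) S, Q). *)
Definition emap (S : lmodType A) (x : modpair B) : modpair A :=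
  ((calE x.1 * S)%type : lmodType A, infl P0 x.2).

(* Pt is an indecomposable projective A-module which is not a projective
   B-module. *)
Definition new_projective (Pt : lmodType A) :=
  [/\ proj Pt, indecomposable Pt
    & ~ exists Q : lmodType B, proj Q /\ iso Pt (infl P0 Q)].
End EMap.

(* Main.v *)
(* For T of finite dimension, T is tau-rigid iff Ext^1(T, Fac T) = 0, and then the
   functions dim Hom(T_i, -) on Fac T, for T_i the indecomposable summands of T, are
   linearly independent combinations of the dim Hom(P_j, -), P_j the indecomposable
   projectives. Hence |T| + |P| <= |C| for every tau-rigid pair (T, P) over C.

   S is the simple module (0, k), and it is injective. Let Z be the common almost
   complete pair of the mutation and suppose that S is not a summand of T'. Counting
   shows that all of E M lies in add T', so S lies in Fac T' as Hom(E M, S) <> 0. Since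
   Fac T' is contained in Fac T and T is tau-rigid with S as a summand, (T' + S, P')
   is a tau-rigid pair with |A| + 1 summands, which is impossible. So T' = Y + S. As
   Hom(S, Y) = 0 and Ext^1(S, Y) = 0, the unit Y -> E (e_B Y) is bijective, and
   Hom(P', S) = 0 makes P' a B-module. E is exact and fully faithful, so e_B Y is
   tau-rigid over B, and the summands of e_B Y and of P' are counted over A. *)
Require Import Defs.
From HB Require Import structures.
From mathcomp Require Import all_boot all_order all_algebra all_field.
From mathcomp Require Import boolp.

Set Implicit Arguments.
Unset Strict Implicit.
Unset Printing Implicit Defensive.

Import GRing.Theory.
Local Open Scope ring_scope.

(* vector.v exports another [Hom]. *)
Local Notation Hom := Defs.Hom.

(** * Linear maps, submodules and quotients *)

(** The obstacle is the mutation that exchanges S itself, after which T' would not contain S at all.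
    The condition Hom(E M, S) <> 0 excludes it, because S would then be a factor of something that
    T' keeps. The count behind this: the common pair (Z, W) has |A| - 1 summands and W lies in add
    P, so Z has at least |T| - 1 = |E M| of them; as Z is a summand of T' none of them is S, and
    they exhaust E M. In the bound |T| + |P| <= |C| the module P enters because dim Hom(P_j, -)
    vanishes on Fac T for P_j in add P; the independent functions of the T_i thus lie in a span of
    |C| - |P| functions. Hom(S, Y) = 0 because a copy of S in Y would split off by injectivity,
    while T' is basic. This vanishing makes the unit injective. That of Ext^1(S, Y) makes it
    surjective: a map U -> e_B Y restricts to P0 and so defines an extension of S by Y, and a
    splitting of it yields a preimage. The number |B| is read off from (M, Q), by comparing the
    counts of T, P and T', P' over A. *)

Section LinearOf.
Context (R : nzRingType) (X Y : lmodType R) (f : X -> Y).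

(** The linearity proof is an argument so that a bundled map can be made in the middle of a proof.
    Maps are obtained below from a formula and used only through their pointwise equation. *)
Definition lin_of (H : linear f) : X -> Y := f.
HB.instance Definition _ (H : linear f) :=
  GRing.isLinear.Build R X Y *:%R (lin_of H) H.

Lemma linear_ex : linear f -> exists g : {linear X -> Y}, forall x, g x = f x.
Proof. by move=> H; exists (lin_of H). Qed.
End LinearOf.

Definition psub (R : nzRingType) (V : lmodType R) (W : V -> Prop) :=
  W 0 /\ forall (a : R) u v, W u -> W v -> W (a *: u + v).

Section SubQuot.
Local Open Scope quotient_scope.
Context (R : nzRingType) (V : lmodType R) (W : V -> Prop) (hW : psub W).

Definition wpred : {pred V} := fun v => `[< W v >].

Fact wpred_submod : submod_closed wpred.
Proof.
case: hW => W0 WD; split; first exact/asboolP.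
by move=> a u v /asboolP Wu /asboolP Wv; apply/asboolP; exact: WD.
Qed.

HB.instance Definition _ := GRing.isSubmodClosed.Build R V wpred wpred_submod.

Record wsub := WSub { wsub_val :> V; _ : wsub_val \in wpred }.
HB.instance Definition _ := [isSub for wsub_val].
HB.instance Definition _ := [Choice of wsub by <:].
HB.instance Definition _ := [SubChoice_isSubLmodule of wsub by <:].

Lemma sub_exists : exists (U : lmodType R) (i : {linear U -> V}),
  injective i /\ forall v, W v <-> exists u, i u = v.
Proof.
exists wsub.
have [g gE] : exists g : {linear wsub -> V}, forall x, g x = val x.
  by apply: linear_ex => a x y; rewrite linearP.
exists g; split=> [x y|v]; first by rewrite !gE => /val_inj.
split=> [Wv|[u <-]].
  have Pv : v \in wpred by apply/asboolP.
  by exists (WSub Pv); rewrite gE.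
by rewrite gE; case: u => u Pu /=; apply/asboolP.
Qed.

Local Notation Q := (Quotient.quot wpred).

Definition wquot_scale (a : R) (x : Q) : Q := \pi_Q (a *: repr x).

Lemma wquot_eq (x y : V) : (\pi_Q x = \pi_Q y) <-> W (x - y).
Proof.
split=> [/eqP|Wxy].
  by rewrite -Quotient.idealrBE => /asboolP.
by apply/eqP; rewrite -Quotient.idealrBE; apply/asboolP.
Qed.

Lemma wquot_scaleE a x : wquot_scale a (\pi_Q x) = \pi_Q (a *: x).
Proof.
apply/wquot_eq; rewrite -scalerBr.
have /wquot_eq H : \pi_Q (repr (\pi_Q x)) = \pi_Q x by rewrite reprK.
by case: hW => W0 /(_ a _ _ H W0); rewrite addr0.
Qed.

Fact wquot_scaleA a b x : wquot_scale a (wquot_scale b x) = wquot_scale (a * b) x.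
Proof.
rewrite -[x]reprK; move: (repr x) => {}x.
by rewrite (wquot_scaleE b) !wquot_scaleE scalerA.
Qed.
Fact wquot_scale1 : left_id 1 wquot_scale.
Proof.
by move=> x; rewrite -[x]reprK; move: (repr x) => {}x; rewrite wquot_scaleE scale1r.
Qed.
Fact wquot_scaleDr : right_distributive wquot_scale +%R.
Proof.
move=> a x y; rewrite -[x]reprK -[y]reprK; move: (repr x) (repr y) => {}x {}y.
rewrite -raddfD (wquot_scaleE a x) (wquot_scaleE a y) (wquot_scaleE a (x + y)).
by rewrite scalerDr raddfD.
Qed.
Fact wquot_scaleDl x : {morph wquot_scale^~ x : a b / a + b}.
Proof.
move=> a b; rewrite -[x]reprK; move: (repr x) => {}x.
by rewrite !wquot_scaleE scalerDl raddfD.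
Qed.
Definition wquot := Q.
HB.instance Definition _ := GRing.Zmodule.on wquot.
HB.instance Definition _ := GRing.Zmodule_isLmodule.Build R wquot
  wquot_scaleA wquot_scale1 wquot_scaleDr wquot_scaleDl.

Lemma quot_exists : exists (U : lmodType R) (p : {linear V -> U}),
  surj p /\ forall v, W v <-> p v = 0.
Proof.
exists wquot.
have [g gE] : exists g : {linear V -> wquot}, forall x, g x = \pi_Q x.
  apply: linear_ex => a x y; rewrite [LHS]raddfD; congr (_ + _).
  exact: esym (wquot_scaleE a x).
exists g; split=> [y|v].
  by exists (repr y); rewrite gE reprK.
rewrite gE -[X in _ = X](raddf0 (\pi_Q)) wquot_eq subr0; split=> //.
Qed.

End SubQuot.

Section Modules.
Context (R : nzRingType).
Implicit Types (M N P X Y Z W E F : lmodType R).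

Lemma factor_surj X Y Z (g : {linear X -> Y}) (f : {linear X -> Z}) :
  surj g -> (forall x, g x = 0 -> f x = 0) ->
  exists h : {linear Y -> Z}, forall x, h (g x) = f x.
Proof.
move=> gs gf; have [s sE] := choice gs.
have fs x : f (s (g x)) = f x.
  by apply/eqP; rewrite -subr_eq0 -linearB; apply/eqP/gf; rewrite linearB /= sE subrr.
have [h hE] : exists h : {linear Y -> Z}, forall y, h y = f (s y).
  apply: linear_ex => a x y.
  by rewrite -[RHS]linearP -[RHS]fs [g _]linearP !sE.
by exists h => x; rewrite hE.
Qed.

Lemma factor_inj X Y Z (i : {linear X -> Y}) (f : {linear Z -> Y}) :
  injective i -> (forall z, exists x, i x = f z) ->
  exists h : {linear Z -> X}, forall z, i (h z) = f z.
Proof.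
move=> ii /choice[s sE].
have [h hE] : exists h : {linear Z -> X}, forall z, h z = s z.
  by apply: linear_ex => a x y; apply: ii; rewrite linearP !sE linearP.
by exists h => z; rewrite hE sE.
Qed.

Lemma inj_linearP X Y (f : {linear X -> Y}) :
  injective f <-> (forall x, f x = 0 -> x = 0).
Proof.
split=> [fi x fx|f0 x y fxy]; first by apply: fi; rewrite fx linear0.
by apply/eqP; rewrite -subr_eq0; apply/eqP/f0; rewrite linearB fxy subrr.
Qed.

Lemma bij_linear_iso X Y (f : {linear X -> Y}) :
  injective f -> surj f -> iso X Y.
Proof. by move=> fi /choice[g gK]; exists f; exists g => // x; apply: fi. Qed.

Lemma isoP X Y : iso X Y <-> exists (f : {linear X -> Y}) (g : {linear Y -> X}),
  cancel f g /\ cancel g f.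
Proof.
split=> [[f [g fg gf]]|[f [g [fg gf]]]]; last by exists f; exists g.
have [g' gE] : exists g' : {linear Y -> X}, forall y, g' y = g y.
  apply: linear_ex => a x y; rewrite -[RHS]fg; congr g.
  by rewrite linearP !gf.
by exists f, g'; split=> x; rewrite gE ?fg ?gf.
Qed.

Lemma iso_refl X : iso X X.
Proof. by exists idfun; exists id. Qed.

Lemma iso_sym X Y : iso X Y -> iso Y X.
Proof. by move=> /isoP[f [g [fg gf]]]; apply/isoP; exists g, f. Qed.

Lemma iso_trans X Y Z : iso X Y -> iso Y Z -> iso X Z.
Proof. by move=> [f fb] [g gb]; exists (g \o f); apply: bij_comp. Qed.

(** Direct summands are handled as retracts, which compose and pass through functors without naming
    a complement; [summandP] translates back. *)
Definition retract X M :=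
  exists (i : {linear X -> M}) (p : {linear M -> X}), cancel i p.

Lemma retract_refl X : retract X X.
Proof. by exists idfun, idfun. Qed.

Lemma retract_trans X Y Z : retract X Y -> retract Y Z -> retract X Z.
Proof.
move=> [i [p ip]] [j [q jq]]; exists (j \o i), (p \o q) => x /=.
by rewrite jq ip.
Qed.

Lemma iso_retract X Y : iso X Y -> retract X Y.
Proof. by move=> /isoP[f [g [fg _]]]; exists f, g. Qed.

Lemma pair_ex X Y Z (f : {linear Z -> X}) (g : {linear Z -> Y}) :
  exists h : {linear Z -> (X * Y)%type}, forall z, h z = (f z, g z).
Proof. by apply: linear_ex => a x y; rewrite !linearP. Qed.

Lemma copair_ex X Y Z (f : {linear X -> Z}) (g : {linear Y -> Z}) :
  exists h : {linear (X * Y)%type -> Z}, forall z, h z = f z.1 + g z.2.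
Proof.
by apply: linear_ex => a x y; rewrite !linearP scalerDr addrACA.
Qed.

Lemma fst_ex X Y : exists h : {linear (X * Y)%type -> X}, forall z, h z = z.1.
Proof. exact: linear_ex. Qed.

Lemma snd_ex X Y : exists h : {linear (X * Y)%type -> Y}, forall z, h z = z.2.
Proof. exact: linear_ex. Qed.

Lemma null_ex X Y : exists h : {linear X -> Y}, forall z, h z = 0.
Proof. by apply: linear_ex => a x y; rewrite scaler0 addr0. Qed.

Lemma pairD X Y (x x' : X) (y y' : Y) : (x, y) + (x', y') = (x + x', y + y').
Proof. by []. Qed.

Lemma pairB X Y (x x' : X) (y y' : Y) : (x, y) - (x', y') = (x - x', y - y').
Proof. by []. Qed.

Lemma inl_ex X Y : exists h : {linear X -> (X * Y)%type}, forall x, h x = (x, 0).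
Proof.
have [n nE] := null_ex X Y; have [h hE] := pair_ex idfun n.
by exists h => x; rewrite hE nE.
Qed.

Lemma inr_ex X Y : exists h : {linear Y -> (X * Y)%type}, forall x, h x = (0, x).
Proof.
have [n nE] := null_ex Y X; have [h hE] := pair_ex n idfun.
by exists h => x; rewrite hE nE.
Qed.

Lemma retract_prodl X Y : retract X (X * Y)%type.
Proof.
have [i iE] := inl_ex X Y; have [p pE] := fst_ex X Y.
by exists i, p => x; rewrite iE pE.
Qed.

Lemma retract_prodr X Y : retract Y (X * Y)%type.
Proof.
have [i iE] := inr_ex X Y; have [p pE] := snd_ex X Y.
by exists i, p => x; rewrite iE pE.
Qed.

Lemma ker_exists X Y (f : {linear X -> Y}) :
  exists (K : lmodType R) (i : {linear K -> X}),
    injective i /\ forall x, f x = 0 <-> exists u, i u = x.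
Proof.
apply: sub_exists; split=> [|a u v fu fv]; first exact: linear0.
by rewrite linearP fu fv scaler0 addr0.
Qed.

Lemma im_exists X Y (f : {linear X -> Y}) :
  exists (K : lmodType R) (i : {linear K -> Y}) (p : {linear X -> K}),
    [/\ injective i, surj p & forall x, i (p x) = f x].
Proof.
have [|K [i [ii iE]]] := @sub_exists R Y (fun y => exists x, f x = y).
  split=> [|a _ _ [x <-] [y <-]]; first by exists 0; rewrite linear0.
  by exists (a *: x + y); rewrite linearP.
have [|p pE] := @factor_inj _ _ _ i f ii; first by move=> x; apply/iE; exists x.
exists K, i, p; split=> // y.
have /iE[x xE] : exists u, i u = i y by exists y.
by exists x; apply: ii; rewrite pE.
Qed.

Lemma retract_split X M (i : {linear X -> M}) (p : {linear M -> X}) :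
  cancel i p -> exists (K : lmodType R) (j : {linear K -> M}),
  [/\ injective j, forall x, p x = 0 <-> exists u, j u = x & iso M (X * K)%type].
Proof.
move=> ip; have [K [j [ji jE]]] := ker_exists p.
exists K, j; split=> //; have [h hE] := copair_ex i j.
apply: iso_sym; apply: (@bij_linear_iso _ _ h).
  apply/inj_linearP => -[x y]; rewrite hE /= => e.
  have pj : p (j y) = 0 by apply/jE; exists y.
  have x0 : x = 0 by have := congr1 p e; rewrite linearD /= ip pj addr0 linear0.
  by move: e; rewrite x0 linear0 add0r => /(inj_linearP _).1 ->.
move=> m; have /jE[u uE] : p (m - i (p m)) = 0 by rewrite linearB /= ip subrr.
by exists (p m, u); rewrite hE /= uE addrC subrK.
Qed.

Lemma summandP X M : summand X M <-> retract X M.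
Proof.
split=> [[Y XY]|[i [p ip]]].
  exact: retract_trans (retract_prodl X Y) (iso_retract (iso_sym XY)).
by have [K [j [_ _ ?]]] := retract_split ip; exists K.
Qed.

Lemma nonzeroPn X : ~ nonzero X <-> forall x : X, x = 0.
Proof.
split=> [/forallNP X0 x|X0 [x]]; first by have /negP := X0 x; rewrite negbK => /eqP.
by rewrite (X0 x) eqxx.
Qed.

Lemma indecP X : indecomposable X <-> nonzero X /\
  forall e : {linear X -> X}, (forall x, e (e x) = e x) ->
    (forall x, e x = 0) \/ (forall x, e x = x).
Proof.
split=> -[X0 XP]; split=> //.
  move=> e ee.
  have [K [i [p [ii ps ip]]]] := im_exists e.
  have pi : cancel i p.
    by move=> y; apply: ii; rewrite ip; have [x <-] := ps y; rewrite !ip ee.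
  have [L [j [ji jE XKL]]] := retract_split pi.
  move/not_andP: (XP _ _ XKL) => [/nonzeroPn K0|/nonzeroPn L0].
    by left=> x; rewrite -[LHS]ip (K0 (p x)) linear0.
  right=> x; have /jE[u] : p (x - i (p x)) = 0 by rewrite linearB /= pi subrr.
  by rewrite (L0 u) linear0 => /esym/eqP; rewrite subr_eq0 ip => /eqP.
move=> Y Z /isoP[f [g [fg gf]]] [[y y0] [z z0]].
have [a aE] := fst_ex Y Z; have [b bE] := inl_ex Y Z.
have [x|eq0|eq1] := XP (g \o (b \o (a \o f))).
- by rewrite /= gf aE bE /= aE bE.
- move: (eq0 (g (y, 0))); rewrite /= gf aE bE /= => /(congr1 f).
  by rewrite gf linear0 => -[/eqP]; apply/negP.
move: (eq1 (g (0, z))); rewrite /= gf aE bE /= => /(congr1 f).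
by rewrite !gf => -[/esym/eqP]; apply/negP.
Qed.
Lemma iso_prod X X' Y Y' :
  iso X X' -> iso Y Y' -> iso (X * Y)%type (X' * Y')%type.
Proof.
move=> /isoP[f [f' [ff' f'f]]] /isoP[g [g' [gg' g'g]]]; apply/isoP.
have [h hE] : exists h : {linear (X * Y)%type -> (X' * Y')%type},
    forall z, h z = (f z.1, g z.2).
  by apply: linear_ex => a x y; rewrite !linearP.
have [h' h'E] : exists h : {linear (X' * Y')%type -> (X * Y)%type},
    forall z, h z = (f' z.1, g' z.2).
  by apply: linear_ex => a x y; rewrite !linearP.
by exists h, h'; split=> -[x y]; rewrite hE h'E /= ?ff' ?gg' ?f'f ?g'g.
Qed.

Lemma iso_prodC X Y : iso (X * Y)%type (Y * X)%type.
Proof.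
have sw (U V : lmodType R) : exists h : {linear (U * V)%type -> (V * U)%type},
  forall z, h z = (z.2, z.1) by exact: linear_ex.
have [h hE] := sw X Y; have [h' h'E] := sw Y X; apply/isoP.
by exists h, h'; split=> -[x y]; rewrite hE h'E.
Qed.

Lemma retract_prod X Y Z :
  retract X Y -> retract (X * Z)%type (Y * Z)%type.
Proof.
move=> /summandP[W YW].
apply: retract_trans (iso_retract (iso_prod (iso_sym YW) (iso_refl Z))).
have [i iE] := inl_ex X W; have [p pE] := fst_ex X W.
have [h hE] : exists h : {linear (X * Z)%type -> ((X * W) * Z)%type},
    forall z, h z = (i z.1, z.2).
  by apply: linear_ex => a x y; rewrite !linearP.
have [h' h'E] : exists h : {linear ((X * W) * Z)%type -> (X * Z)%type},
    forall z, h z = (p z.1, z.2).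
  by apply: linear_ex => a x y; rewrite !linearP.
by exists h, h' => -[x y]; rewrite hE h'E /= pE iE.
Qed.

Lemma retract_basic X M :
  retract X M -> basic M -> basic X.
Proof.
move=> XM Mb Y Yi /summandP YX; apply: (Mb Y Yi); apply/summandP.
exact: retract_trans YX XM.
Qed.

Lemma hom_nonzero_iso X X' Y Y' :
  iso X X' -> iso Y Y' -> hom_nonzero X Y -> hom_nonzero X' Y'.
Proof.
move=> /isoP[f [f' [ff' f'f]]] /isoP[g [g' [gg' g'g]]] [h [x hx]].
exists (g \o (h \o f')), (f x); rewrite /= ff'.
by apply: contraNneq hx => /(congr1 g'); rewrite gg' linear0 => ->.
Qed.

End Modules.

(** * Projective modules, Fac, and vanishing of Ext^1(M, -) on Fac Z *)

Section RelativeProjectivity.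
Context (R : nzRingType).
Implicit Types (M N P Q X Y Z E F : lmodType R).

Lemma combination_ex P (I : finType) (h : I -> {linear P -> R^o}) E (v : I -> E) :
  exists w : {linear P -> E}, forall x, w x = \sum_i h i x *: v i.
Proof.
apply: linear_ex => a x y; rewrite scaler_sumr -big_split /=.
by apply: eq_bigr => i _; rewrite linearP scalerDl scalerA.
Qed.

Lemma free_comb_ex (I : finType) E (v : I -> E) :
  exists w : {linear {ffun I -> R^o} -> E}, forall x, w x = \sum_i x i *: v i.
Proof.
apply: linear_ex => a x y; rewrite scaler_sumr -big_split /=.
by apply: eq_bigr => i _; rewrite !ffunE scalerDl scalerA.
Qed.

Lemma ffun_map_ex (I : finType) E F (f : I -> {linear E -> F}) :
  exists w : {linear E -> {ffun I -> F}}, forall x, w x = [ffun i => f i x].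
Proof. by apply: linear_ex => a x y; apply/ffunP => i; rewrite !ffunE linearP. Qed.

Lemma ffun_proj_ex (I : finType) E (i : I) :
  exists w : {linear {ffun I -> E} -> E}, forall x, w x = x i.
Proof. by apply: linear_ex => a x y; rewrite !ffunE. Qed.

Lemma ffun_sum_ex (I : finType) E F (f : I -> {linear E -> F}) :
  exists w : {linear {ffun I -> E} -> F}, forall x, w x = \sum_i f i (x i).
Proof.
apply: linear_ex => a x y; rewrite scaler_sumr -big_split /=.
by apply: eq_bigr => i _; rewrite !ffunE linearP.
Qed.

Lemma fingenP M :
  fingen M <-> exists n (g : {linear {ffun 'I_n -> R^o} -> M}), surj g.
Proof.
split=> [[s sP]|[n [g gs]]].
  have [g gE] := free_comb_ex (fun i : 'I_(size s) => s`_i).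
  exists (size s), g => x; have [c ->] := sP x.
  by exists [ffun i => c i]; rewrite gE; apply: eq_bigr => i _; rewrite ffunE.
pose d (i : 'I_n) : {ffun 'I_n -> R^o} := [ffun j => (i == j)%:R].
exists (mkseq (fun i => if insub i is Some j then g (d j) else 0) n) => x.
have [y <-] := gs x; rewrite size_mkseq.
exists y; transitivity (g (\sum_i y i *: d i)).
  congr (g _); apply/ffunP => j; rewrite sum_ffunE (bigD1 j) //= big1 => [|i ij].
    by rewrite !ffunE eqxx [_ *: _]mulr1 addr0.
  by rewrite !ffunE (negPf ij) [_ *: _]mulr0.
rewrite linear_sum; apply: eq_bigr => i _.
by rewrite linearZ nth_mkseq // insubT //= => ?; congr (_ *: g (d _)); apply: val_inj.
Qed.

Lemma free_projective n : projective {ffun 'I_n -> R^o}.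
Proof.
move=> X Y g f /choice[s sE].
pose d (i : 'I_n) : {ffun 'I_n -> R^o} := [ffun j => (i == j)%:R].
have [h hE] := free_comb_ex (fun i => s (f (d i))).
exists h => x; rewrite hE linear_sum /=.
under eq_bigr => i _ do rewrite linearZ /= sE -linearZ.
rewrite -linear_sum; congr (f _); apply/ffunP => j.
rewrite sum_ffunE (bigD1 j) //= big1 => [|i ij].
  by rewrite !ffunE eqxx [_ *: _]mulr1 addr0.
by rewrite !ffunE (negPf ij) [_ *: _]mulr0.
Qed.

Lemma free_proj n : proj {ffun 'I_n -> R^o}.
Proof.
by split; [apply/fingenP; exists n, idfun => x; exists x | exact: free_projective].
Qed.

Lemma fingen_surj X Y (g : {linear X -> Y}) : surj g -> fingen X -> fingen Y.
Proof.
move=> gs /fingenP[n [h hs]]; apply/fingenP; exists n, (g \o h) => y.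
by have [x <-] := gs y; have [z <-] := hs x; exists z.
Qed.

Lemma retract_surj X Y : retract X Y -> exists p : {linear Y -> X}, surj p.
Proof. by move=> [i [p ip]]; exists p => x; exists (i x). Qed.

Lemma retract_fingen X M : retract X M -> fingen M -> fingen X.
Proof. by move=> /retract_surj[p]; exact: fingen_surj. Qed.

Lemma retract_projective X M : retract X M -> projective M -> projective X.
Proof.
move=> [i [p ip]] Mp Y Z g f gs; have [h hE] := Mp _ _ g (f \o p) gs.
by exists (h \o i) => x /=; rewrite hE /= ip.
Qed.

Lemma retract_proj X M : retract X M -> proj M -> proj X.
Proof.
by move=> XM [fM pM]; split; [apply: retract_fingen fM | apply: retract_projective pM].
Qed.

(** The dual basis lemma: the [h i] are the coordinates of a section of a free cover. *)
Lemma proj_basis P : proj P -> exists n (x : 'I_n -> P)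
  (h : 'I_n -> {linear P -> R^o}), forall y, y = \sum_i h i y *: x i.
Proof.
move=> [[s sP] pP].
have [g gE] := free_comb_ex (fun i : 'I_(size s) => s`_i).
have gs : surj g.
  move=> x; have [c ->] := sP x.
  by exists [ffun i => c i]; rewrite gE; apply: eq_bigr => i _; rewrite ffunE.
have [h hE] := pP _ _ g idfun gs.
have [q qE] := choice (fun i : 'I_(size s) => ffun_proj_ex R^o i).
exists (size s), (fun i => s`_i), (fun i => q i \o h) => y.
by rewrite -[LHS]/(idfun y) -hE gE; apply: eq_bigr => i _; rewrite /= qE.
Qed.

(** The map q need not be onto: the generators of a dual basis are lifted one by one, which only
    asks that q reach the image of u. *)
Lemma proj_lift P E F (q : {linear E -> F}) (u : {linear P -> F}) :
  proj P -> (forall x, exists y, q y = u x) ->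
  exists w : {linear P -> E}, forall x, q (w x) = u x.
Proof.
move=> /proj_basis[n [x [h xE]]] /choice[s sE].
have [w wE] := combination_ex h (fun i => s (x i)).
exists w => y; rewrite wE [in RHS](xE y) !linear_sum; apply: eq_bigr => i _.
by rewrite !linearZ /= sE.
Qed.

(* [relproj M Z] says that Ext^1(M, -) vanishes on Fac Z; kernels in Fac Z are
   given by a surjection from a power of Z. *)
Definition relproj M Z := forall E F (I : finType)
  (q : {linear {ffun I -> Z} -> E}) (g : {linear E -> F}),
  surj g -> (forall y, g y = 0 <-> exists x, q x = y) ->
  forall f : {linear M -> F}, exists h : {linear M -> E}, forall x, g (h x) = f x.

Lemma retract_relproj X M Z : retract X M -> relproj M Z -> relproj X Z.
Proof.
move=> [i [p ip]] Mp E F I q g gs gq f.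
have [h hE] := Mp _ _ _ q g gs gq (f \o p).
by exists (h \o i) => x /=; rewrite hE /= ip.
Qed.

Lemma relproj_prod X Y Z : relproj X Z -> relproj Y Z -> relproj (X * Y)%type Z.
Proof.
move=> Xp Yp E F I q g gs gq f.
have [i iE] := inl_ex X Y; have [j jE] := inr_ex X Y.
have [h hE] := Xp _ _ _ q g gs gq (f \o i).
have [l lE] := Yp _ _ _ q g gs gq (f \o j).
have [c cE] := copair_ex h l; exists c => -[x y].
rewrite cE linearD /= hE lE /= iE jE -linearD; congr (f _).
by rewrite pairD addr0 add0r.
Qed.

(** A factor of a power of Z' is a factor of a power of Z; the two exponents merge into one index
    set of pairs. *)
Lemma relproj_Fac M Z Z' : Fac Z Z' -> relproj M Z -> relproj M Z'.
Proof.
move=> [n [p ps]] Mp E F I q g gs gq f.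
have [r rE] : exists r : {linear {ffun I * 'I_n -> Z} -> {ffun I -> Z'}},
    forall z, r z = [ffun i => p [ffun j => z (i, j)]].
  apply: linear_ex => a x y; apply/ffunP => i; rewrite !ffunE -linearP.
  by congr (p _); apply/ffunP => j; rewrite !ffunE.
apply: (Mp _ _ _ (q \o r) g gs) => y; split=> [/gq[x <-]|[x <-]].
  have [s sE] := choice (fun i => ps (x i)).
  exists [ffun ij => s ij.1 ij.2] => /=; congr (q _); apply/ffunP => i.
  by rewrite rE ffunE -sE; congr (p _); apply/ffunP => j; rewrite !ffunE.
by apply/gq; exists (r x).
Qed.

Lemma Fac_surj Z X Y (f : {linear X -> Y}) : surj f -> Fac Z X -> Fac Z Y.
Proof.
move=> fs [n [p ps]]; exists n, (f \o p) => y.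
by have [x <-] := fs y; have [z <-] := ps x; exists z.
Qed.

Lemma Fac_refl Z : Fac Z Z.
Proof.
have [p pE] := ffun_proj_ex Z (@ord0 0).
by exists 1, p => x; exists [ffun=> x]; rewrite pE ffunE.
Qed.

Lemma Fac_retract X M : retract X M -> Fac M X.
Proof. by move=> /retract_surj[p ps]; exact: Fac_surj ps (Fac_refl M). Qed.

Lemma Fac_prod Z X Y : Fac Z X -> Fac Z Y -> Fac Z (X * Y)%type.
Proof.
move=> [m [p ps]] [n [q qs]].
have [l lE] : exists l : {linear {ffun 'I_(m + n) -> Z} -> {ffun 'I_m -> Z}},
    forall z, l z = [ffun i => z (lshift n i)].
  by apply: linear_ex => a x y; apply/ffunP => i; rewrite !ffunE.
have [r rE] : exists r : {linear {ffun 'I_(m + n) -> Z} -> {ffun 'I_n -> Z}},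
    forall z, r z = [ffun i => z (rshift m i)].
  by apply: linear_ex => a x y; apply/ffunP => i; rewrite !ffunE.
have [c cE] := pair_ex (p \o l) (q \o r).
exists (m + n)%N, c => -[x y]; have [x' <-] := ps x; have [y' <-] := qs y.
exists [ffun i => match split i with inl i => x' i | inr i => y' i end].
rewrite cE /= lE rE; congr (p _, q _); apply/ffunP => i; rewrite !ffunE.
  by rewrite (unsplitK (inl i)).
by rewrite (unsplitK (inr i)).
Qed.

(** A map from P lifts to a power of Z and has a nonzero coordinate there. Hence vanishing of Hom(P,
    -) spreads from Z to all of Fac Z. *)
Lemma hom_nonzero_Fac P Z X : projective P -> Fac Z X ->
  hom_nonzero P X -> hom_nonzero P Z.
Proof.
move=> Pp [n [p ps]] [f [x fx]]; have [h hE] := Pp _ _ p f ps.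
have [i hi] : exists i, h x i != 0.
  apply: contrapT => /forallNP h0; move: fx; rewrite -hE.
  suff -> : h x = 0 by rewrite linear0 eqxx.
  by apply/ffunP => i; have /negP := h0 i; rewrite negbK ffunE => /eqP.
have [q qE] := ffun_proj_ex Z i.
by exists (q \o h), x; rewrite /= qE.
Qed.
Lemma proj_prod P Q :
  proj P -> proj Q -> proj (P * Q)%type.
Proof.
move=> [/fingenP Pf Pp] [/fingenP Qf Qp]; split.
  (* Finite generation is membership in Fac of the regular module. *)
  by apply/fingenP; exact: (Fac_prod (Z := R^o) Pf Qf).
move=> X Y g f gs.
have [l lE] := inl_ex P Q; have [r rE] := inr_ex P Q.
have [h hE] := Pp _ _ g (f \o l) gs; have [h' h'E] := Qp _ _ g (f \o r) gs.
have [c cE] := copair_ex h h'; exists c => -[x y].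
by rewrite cE linearD /= hE h'E /= lE rE -linearD pairD addr0 add0r.
Qed.

Lemma proj_regular : proj R^o.
Proof.
apply: retract_proj (free_proj 1).
have [p pE] := ffun_proj_ex R^o (@ord0 0).
have [i iE] := ffun_map_ex (fun _ : 'I_1 => (idfun : {linear R^o -> R^o})).
by exists i, p => x; rewrite pE iE ffunE.
Qed.

End RelativeProjectivity.

(** * Dimensions *)

Section Dimension.
Context (k : fieldType).
Implicit Types (U V W : lmodType k).

Definition dim_is V n := exists f : {linear V -> 'rV[k]_n}, bijective f.

Definition fdim V := exists n, dim_is V n.

Lemma fdim_rV n : fdim 'rV[k]_n.
Proof. by exists n; exact: iso_refl. Qed.

(* 0 on infinite-dimensional spaces. *)
Definition dimk V : nat :=
  if pselect (fdim V) is left h then projT1 (cid h) else 0%N.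

Lemma coord_ex n (j : 'I_n) : exists c : {linear 'rV[k]_n -> k^o},
  forall u, c u = u 0 j.
Proof. by apply: linear_ex => a x y; rewrite !mxE. Qed.

Lemma rV_comb_ex n V (v : 'I_n -> V) :
  exists w : {linear 'rV[k]_n -> V}, forall u, w u = \sum_i u 0 i *: v i.
Proof.
have [c cE] := choice (@coord_ex n); have [w wE] := combination_ex c v.
by exists w => u; rewrite wE; apply: eq_bigr => i _; rewrite cE.
Qed.

Lemma rV_inj_leq m n (f : {linear 'rV[k]_m -> 'rV[k]_n}) : injective f -> (m <= n)%N.
Proof.
move=> fi; suff : row_free (lin1_mx f).
  by rewrite /row_free => /eqP <-; exact: rank_leq_col.
rewrite -kermx_eq0; apply/eqP/row_matrixP => i; rewrite row0.
apply: fi; rewrite linear0 -mul_rV_lin1 -row_mul mulmx_ker; exact: row0.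
Qed.

Lemma rV_lift V W n (g : {linear V -> W}) (f : {linear 'rV[k]_n -> W}) :
  surj g -> exists s : {linear 'rV[k]_n -> V}, forall x, g (s x) = f x.
Proof.
move=> /choice[t tE].
have [s sE] := rV_comb_ex (fun i => t (f (delta_mx 0 i))).
exists s => x; rewrite sE [in RHS](row_sum_delta x) !linear_sum.
by apply: eq_bigr => i _; rewrite !linearZ /= tE.
Qed.

(** An independent family of maximal length, seen as an injection of k^n, is a basis: a vector
    outside its image could be adjoined. *)
Lemma fdim_bounded V m :
  (forall r (g : {linear 'rV[k]_r -> V}), injective g -> (r <= m)%N) ->
  exists2 n, (n <= m)%N & dim_is V n.
Proof.
move=> bnd; pose P r := `[< exists g : {linear 'rV[k]_r -> V}, injective g >].
have P0 : exists r, P r.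
  exists 0%N; apply/asboolP; have [n _] := null_ex 'rV[k]_0 V.
  by exists n => x y _; rewrite [x]thinmx0 [y]thinmx0.
have Pm r : P r -> (r <= m)%N by move=> /asboolP[g /bnd].
case: (ex_maxnP P0 Pm) => n /asboolP[g gi] nmax.
exists n; first by apply: Pm; apply/asboolP; exists g.
apply: iso_sym; apply: (bij_linear_iso gi) => v; apply: contrapT => /forallNP gv.
have : (n + 1 <= n)%N; last by rewrite addn1 ltnn.
apply: nmax; apply/asboolP.
have [h hE] : exists h : {linear 'rV[k]_(n + 1) -> V},
    forall x, h x = g (lsubmx x) + rsubmx x 0 0 *: v.
  apply: linear_ex => a x y; rewrite !linearP !mxE scalerDr scalerDl scalerA.
  by rewrite addrACA.
exists h; apply/inj_linearP => x; rewrite hE => e.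
have r0 : rsubmx x 0 0 = 0.
  apply/eqP; apply: contraPT e => r0 e; apply: (gv (- (rsubmx x 0 0)^-1 *: lsubmx x)).
  rewrite linearZ /= scaleNr; move/eqP: e; rewrite addr_eq0 => /eqP ->.
  by rewrite scalerN opprK scalerA mulVf // scale1r.
move: e; rewrite r0 scale0r addr0 => /(inj_linearP _).1 => /(_ gi) l0.
rewrite -[x]hsubmxK; have -> : rsubmx x = 0.
  by apply/matrixP => i j; rewrite !ord1 r0 mxE.
by rewrite l0 row_mx0.
Qed.

Lemma dim_inj V W n m (f : {linear V -> W}) :
  injective f -> dim_is V n -> dim_is W m -> (n <= m)%N.
Proof.
move=> fi /isoP[g [g' [gg' g'g]]] [h hb].
apply: (@rV_inj_leq _ _ (h \o (f \o g'))) => x y /= /(bij_inj hb)/fi.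
exact: can_inj.
Qed.

Lemma dim_uniq V n m : dim_is V n -> dim_is V m -> n = m.
Proof.
move=> Vn Vm; apply/eqP; rewrite eqn_leq.
have le p q : dim_is V p -> dim_is V q -> (p <= q)%N.
  by apply: (@dim_inj V V p q idfun).
by rewrite !le.
Qed.

Lemma dimk_eq V n : dim_is V n -> dimk V = n.
Proof.
rewrite /dimk; case: pselect => [h|/forallNP h /h//].
by case: cid => /= m Vm /(dim_uniq Vm).
Qed.

Lemma dimkP V : fdim V -> dim_is V (dimk V).
Proof. by case=> n Vn; rewrite (dimk_eq Vn). Qed.

Lemma dim_iso V W n : iso V W -> dim_is V n -> dim_is W n.
Proof. by move=> VW Vn; apply: iso_trans (iso_sym VW) Vn. Qed.

Lemma fdim_inj V W (f : {linear V -> W}) : injective f -> fdim W ->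
  fdim V /\ (dimk V <= dimk W)%N.
Proof.
move=> fi [m Wm]; have [r g gi|n nm Vn] := @fdim_bounded V m.
  apply: (@dim_inj _ _ _ _ (f \o g)) Wm => [x y /= /fi/gi //|].
  exact: iso_refl.
by split; [exists n | rewrite (dimk_eq Vn) (dimk_eq Wm)].
Qed.

Lemma fdim_sub V W (f : {linear V -> W}) : injective f -> fdim W -> fdim V.
Proof. by move=> fi /(fdim_inj fi)[]. Qed.

Lemma fdim_surj V W (f : {linear V -> W}) : surj f -> fdim V ->
  fdim W /\ (dimk W <= dimk V)%N.
Proof.
move=> fs [m Vm]; have [r g gi|n nm Wn] := @fdim_bounded W m.
  have [s sE] := rV_lift g fs.
  apply: (@dim_inj _ _ _ _ s) Vm; last exact: iso_refl.
  by move=> x y sxy; apply: gi; rewrite -!sE sxy.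
by split; [exists n | rewrite (dimk_eq Vm) (dimk_eq Wn)].
Qed.

Lemma dim_prod V W n m :
  dim_is V n -> dim_is W m -> dim_is (V * W)%type (n + m).
Proof.
move=> [f fb] [g gb].
have [h hE] : exists h : {linear (V * W)%type -> 'rV[k]_(n + m)},
    forall x, h x = row_mx (f x.1) (g x.2).
  by apply: linear_ex => a x y; rewrite !linearP scale_row_mx add_row_mx.
exists h; have [f' ff' f'f] := fb; have [g' gg' g'g] := gb.
exists (fun u => (f' (lsubmx u), g' (rsubmx u))) => [[x y]|u].
  by rewrite hE row_mxKl row_mxKr /= ff' gg'.
by rewrite hE /= f'f g'g hsubmxK.
Qed.

Lemma dim_exact U V W (i : {linear U -> V}) (g : {linear V -> W}) :
  injective i -> surj g -> (forall v, g v = 0 <-> exists u, i u = v) ->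
  fdim U -> fdim W -> fdim V /\ dimk V = (dimk U + dimk W)%N.
Proof.
move=> ii gs gi /dimkP Ud /dimkP Wd.
have [w [w' [ww' w'w]]] := (isoP _ _).1 Wd.
have [s sE] := rV_lift w' gs.
have [h hE] := copair_ex i (s \o w).
suff /dim_iso/(_ (dim_prod Ud Wd)) Vd : iso (U * W)%type V.
  by split; [exists (dimk U + dimk W)%N | rewrite (dimk_eq Vd)].
apply: (@bij_linear_iso _ _ _ h).
  apply/inj_linearP => -[x y]; rewrite hE /= => e.
  have gix : g (i x) = 0 by apply/gi; exists x.
  have y0 : y = 0.
    by have := congr1 g e; rewrite linearD /= sE ww' gix add0r linear0.
  by move: e; rewrite y0 !linear0 addr0 => /(inj_linearP _).1 ->.
move=> v; have /gi[u uE] : g (v - s (w (g v))) = 0.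
  by rewrite linearB /= sE ww' subrr.
by exists (u, g v); rewrite hE /= uE subrK.
Qed.

Lemma dim_inj_surj V W (f : {linear V -> W}) :
  injective f -> fdim W -> (dimk W <= dimk V)%N -> surj f.
Proof.
move=> fi Wd VW.
have [Q [p [ps pE]]] : exists (U : lmodType k) (p : {linear W -> U}),
    surj p /\ forall v, (exists x, f x = v) <-> p v = 0.
  apply: quot_exists; split=> [|a _ _ [x <-] [y <-]]; first by exists 0; rewrite linear0.
  by exists (a *: x + y); rewrite linearP.
have [Vd _] := fdim_inj fi Wd; have [Qd _] := fdim_surj ps Wd.
have [|_ e] := dim_exact fi ps _ Vd Qd.
  by move=> v; split=> /pE.
have Q0 : dimk Q = 0%N.
  by apply/eqP; move: VW; rewrite e -[leqRHS]addn0 leq_add2l leqn0.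
move=> w; apply/pE.
have [q qb] := dimkP Qd; apply: (bij_inj qb); rewrite Q0 in q qb *.
by rewrite [LHS]thinmx0 [RHS]thinmx0.
Qed.

Lemma functional V (v : V) : fdim V -> v != 0 ->
  exists l : {linear V -> k^o}, l v = 1.
Proof.
move=> [n [f fb]] v0.
have [j fj] : exists j, f v 0 j != 0.
  apply: contrapT => /forallNP f0; case/negP: v0; apply/eqP/(bij_inj fb).
  rewrite linear0; apply/rowP => j; rewrite mxE; apply/eqP.
  by apply: contrapT => /negP /f0.
have [l lE] : exists l : {linear V -> k^o}, forall x, l x = (f v 0 j)^-1 * f x 0 j.
  apply: linear_ex => a x y; rewrite linearP !mxE mulrDr; congr (_ + _).
  by rewrite mulrCA.
by exists l; rewrite lE mulVf.
Qed.

Lemma functional_coker V W (f : {linear V -> W}) : fdim W -> ~ surj f ->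
  exists (l : {linear W -> k^o}) (w : W), l w = 1 /\ forall x, l (f x) = 0.
Proof.
move=> Wd fs.
have [Q [p [ps pE]]] : exists (U : lmodType k) (p : {linear W -> U}),
    surj p /\ forall v, (exists x, f x = v) <-> p v = 0.
  apply: quot_exists; split=> [|a _ _ [x <-] [y <-]]; first by exists 0; rewrite linear0.
  by exists (a *: x + y); rewrite linearP.
have [Qd _] := fdim_surj ps Wd.
move: fs => /existsNP[w wf].
have pw : p w != 0 by apply/negP => /eqP/pE.
have [l lE] := functional Qd pw.
exists (l \o p), w; split=> //= x.
by have /pE -> : exists y, f y = f x by [exists x]; rewrite linear0.
Qed.

Lemma fdim_ffun (I : finType) V : fdim V -> fdim {ffun I -> V}.
Proof.
move=> [n [f fb]].
have [g gE] : exists g : {linear {ffun I -> V} -> 'rV[k]_(#|I| * n)},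
    forall x, g x = mxvec (\matrix_(i, j) f (x (enum_val i)) 0 j).
  apply: linear_ex => a x y; rewrite -linearP; congr mxvec.
  by apply/matrixP => i j; rewrite !mxE !ffunE linearP !mxE.
apply: (fdim_sub (f := g)) (fdim_rV _).
move=> x y; rewrite !gE => /(can_inj mxvecK)/matrixP e.
apply/ffunP => i; apply: (bij_inj fb); apply/rowP => j.
by have := e (enum_rank i) j; rewrite !mxE enum_rankK.
Qed.

Lemma dependent_seq V (v : nat -> V) : fdim V ->
  exists n (c : nat -> k), (exists2 i, (i < n)%N & c i != 0) /\
    \sum_(i < n) c i *: v i = 0.
Proof.
move=> [n Vn]; have [w wE] := rV_comb_ex (fun i : 'I_n.+1 => v i).
have : ~ injective w.
  by move=> wi; have := dim_inj wi (iso_refl _) Vn; rewrite ltnn.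
move=> /inj_linearP/existsNP[u /not_implyP[wu /eqP u0]].
exists n.+1, (fun i => u 0 (inord i)); split.
  apply: contrapT => /forall2NP c0; case/negP: u0; apply/eqP/rowP => j.
  have [/(_ (ltn_ord j))//|/negP] := c0 j.
  by rewrite inord_val negbK mxE => /eqP.
rewrite -[RHS]wu wE; apply: eq_bigr => i _.
  by rewrite inord_val.
Qed.
End Dimension.

Lemma falg_fdim (k : fieldType) (B : falgType k) : fdim (B : lmodType k).
Proof.
have [f fE] : exists f : {linear B -> 'rV[k]_(\dim {:B})},
    forall x, f x = \row_i coord (vbasis {:B}) i x.
  by apply: linear_ex => a x y; apply/rowP => i; rewrite !mxE linearP.
apply: (fdim_sub (f := f)) (fdim_rV _ _) => x y; rewrite !fE => /rowP xy.
rewrite (coord_vbasis (memvf x)) (coord_vbasis (memvf y)).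
by apply: eq_bigr => i _; have := xy i; rewrite !mxE => ->.
Qed.

(** * Hom spaces over k and finite-dimensional modules *)

Section HomSpace.
Context (k : fieldType) (C : algType k).
Implicit Types (X Y Z : lmodType C).

Definition kmod X : lmodType k := restr (in_alg C) X.

Lemma kmod_scale X (c : k) (x : kmod X) : c *: x = c%:A *: (x : X).
Proof. by []. Qed.

Lemma kmod_lin X Y (f : {linear X -> Y}) :
  exists g : {linear kmod X -> kmod Y}, forall x, g x = f x.
Proof. by apply: (@linear_ex k (kmod X) (kmod Y)) => a x y; exact: linearP. Qed.

(** A copy of [Hom] to carry the k-structure; the multiple of a map by c stays C-linear because
    [c%:A] is central. *)
Definition homk X Y : Type := Hom X Y.
HB.instance Definition _ X Y := GRing.Zmodule.on (homk X Y).

Section Scale.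
Context (X Y : lmodType C).

Definition homk_fun (c : k) (f : homk X Y) (x : X) : Y :=
  c%:A *: (f : Hom X Y) x.
Fact homk_fun_linear c f : linear (homk_fun c f).
Proof.
move=> a x y; rewrite /homk_fun linearP scalerDr !scalerA.
by congr (_ *: _ + _); rewrite -scalerAl -scalerAr mul1r mulr1.
Qed.
HB.instance Definition _ c f :=
  GRing.isLinear.Build C X Y *:%R (homk_fun c f) (homk_fun_linear c f).
Definition homk_scale c (f : homk X Y) : homk X Y := (homk_fun c f : {linear X -> Y}).

Fact homk_scaleA a b f : homk_scale a (homk_scale b f) = homk_scale (a * b) f.
Proof.
apply: HomP => x; rewrite /= /homk_fun /= /homk_fun scalerA.
by rewrite -scalerAl mul1r scalerA.
Qed.
Fact homk_scale1 : left_id 1 homk_scale.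
Proof. by move=> f; apply: HomP => x; rewrite /= /homk_fun !scale1r. Qed.
Fact homk_scaleDr : right_distributive homk_scale +%R.
Proof. by move=> a f g; apply: HomP => x; rewrite /= /homk_fun scalerDr. Qed.
Fact homk_scaleDl f : {morph homk_scale^~ f : a b / a + b}.
Proof. by move=> a b; apply: HomP => x; rewrite /= /homk_fun !scalerDl. Qed.

HB.instance Definition _ := GRing.Zmodule_isLmodule.Build k (homk X Y)
  homk_scaleA homk_scale1 homk_scaleDr homk_scaleDl.

Lemma homkD (f g : homk X Y) x :
  (f + g : Hom X Y) x = (f : Hom X Y) x + (g : Hom X Y) x.
Proof. by []. Qed.

Lemma homkZ c (f : homk X Y) x :
  (c *: f : homk X Y) x = c%:A *: (f : Hom X Y) x.
Proof. by []. Qed.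

Lemma homk_sumE (I : finType) (c : I -> k) (f : I -> homk X Y) x :
  (\sum_i c i *: f i : homk X Y) x = \sum_i (c i)%:A *: (f i : Hom X Y) x.
Proof.
have [e eE] : exists e : {linear homk X Y -> kmod Y}, forall f, e f = (f : Hom X Y) x.
  exact: linear_ex.
by rewrite -eE linear_sum; apply: eq_bigr => i _; rewrite linearZ /= eE.
Qed.
End Scale.

Lemma precomp_ex X Y Z (f : {linear X -> Y}) :
  exists g : {linear homk Y Z -> homk X Z},
    forall h x, (g h : Hom X Z) x = (h : Hom Y Z) (f x).
Proof.
have [g gE] : exists g : {linear homk Y Z -> homk X Z},
    forall h, g h = ((h : Hom Y Z) \o f : {linear X -> Z}).
  by apply: linear_ex => a u v; apply: HomP.
by exists g => h x; rewrite gE.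
Qed.

Lemma postcomp_ex X Y Z (f : {linear X -> Y}) :
  exists g : {linear homk Z X -> homk Z Y},
    forall h x, (g h : Hom Z Y) x = f ((h : Hom Z X) x).
Proof.
have [g gE] : exists g : {linear homk Z X -> homk Z Y},
    forall h, g h = (f \o (h : Hom Z X) : {linear Z -> Y}).
  by apply: linear_ex => a u v; apply: HomP => x; rewrite /= linearD /= linearZ.
by exists g => h x; rewrite gE.
Qed.

Definition fdm X := fdim (kmod X).
Definition hd X Y := dimk (homk X Y).

Lemma fdm_inj X Y (f : {linear X -> Y}) : injective f -> fdm Y ->
  fdm X /\ (dimk (kmod X) <= dimk (kmod Y))%N.
Proof.
move=> fi; have [g gE] := kmod_lin f; apply: (@fdim_inj _ _ _ g) => x y.
by rewrite !gE => /fi.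
Qed.

Lemma fdm_surj X Y (f : {linear X -> Y}) : surj f -> fdm X ->
  fdm Y /\ (dimk (kmod Y) <= dimk (kmod X))%N.
Proof.
move=> fs; have [g gE] := kmod_lin f; apply: (@fdim_surj _ _ _ g) => y.
by have [x <-] := fs y; exists x; rewrite gE.
Qed.

Lemma fdm_retract X Y : retract X Y -> fdm Y -> fdm X.
Proof.
by move=> /retract_surj[p ps] Yd; have [] := fdm_surj ps Yd.
Qed.

Lemma fdm_prod X Y : fdm X -> fdm Y ->
  fdm (X * Y)%type /\ dimk (kmod (X * Y)%type) = (dimk (kmod X) + dimk (kmod Y))%N.
Proof.
move=> Xd Yd; have [i iE] := inl_ex X Y; have [p pE] := snd_ex X Y.
have [i' i'E] := kmod_lin i; have [p' p'E] := kmod_lin p.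
apply: (@dim_exact _ _ _ _ i' p') => //.
- by move=> x y; rewrite !i'E !iE => -[].
- by move=> y; exists (0, y); rewrite p'E pE.
move=> v; rewrite p'E pE; split=> [|[u <-]]; last by rewrite i'E iE.
by case: v => x y /= ->; exists x; rewrite i'E iE.
Qed.

Lemma fdm_ffun (I : finType) X : fdm X -> fdm {ffun I -> X}.
Proof.
move=> Xd; apply: (@fdim_sub _ (kmod {ffun I -> X}) {ffun I -> kmod X} idfun) => //.
exact: fdim_ffun.
Qed.

Lemma fdim_hom X Y : fingen X -> fdm Y -> fdim (homk X Y).
Proof.
move=> [s sP] Yd.
have [e eE] : exists e : {linear homk X Y -> {ffun 'I_(size s) -> kmod Y}},
    forall f, e f = [ffun i : 'I_(size s) => (f : Hom X Y) s`_i].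
  by apply: linear_ex => a f g; apply/ffunP => i; rewrite !ffunE.
apply: (fdim_sub (f := e)); last exact: fdim_ffun.
move=> f g; rewrite !eE => /ffunP fg; apply: HomP => x.
have [c ->] := sP x; rewrite !linear_sum; apply: eq_bigr => i _.
by rewrite !linearZ /=; have := fg i; rewrite !ffunE => ->.
Qed.

Lemma fdm_fingen X : fdm X -> fingen X.
Proof.
move=> [n /isoP[f [g [fg gf]]]]; exists (mkseq (fun i =>
  if insub i is Some j then g (delta_mx 0 j) else 0) n) => x.
rewrite size_mkseq; exists (fun i => (f x 0 i)%:A).
rewrite -[LHS]fg {1}(row_sum_delta (f x)) linear_sum; apply: eq_bigr => i _.
by rewrite linearZ nth_mkseq ?insubT //= => ?; congr (_ *: g (delta_mx _ _)); apply: val_inj.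
Qed.

Hypothesis Cd : fdim (C : lmodType k).

Lemma fdm_regular : fdm C^o.
Proof.
have [f fE] : exists f : {linear kmod C^o -> C}, forall x, f x = x.
  apply: (@linear_ex k (kmod C^o) C) => a x y /=.
  by rewrite kmod_scale [_ *: (x : C^o)]/GRing.scale /= -scalerAl mul1r.
by apply: (fdim_sub (f := f)) => // x y; rewrite !fE.
Qed.

Lemma fingen_fdm X : fingen X -> fdm X.
Proof.
by move=> /fingenP[n [g gs]]; have [] := fdm_surj gs (fdm_ffun _ fdm_regular).
Qed.
End HomSpace.

(** * Fitting's lemma and Krull-Schmidt *)

Section KrullSchmidt.
Context (k : fieldType) (C : algType k).
Implicit Types (X Y Z M P : lmodType C).

Lemma iter_linear X (f : {linear X -> X}) n :
  exists g : {linear X -> X}, forall x, g x = iter n f x.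
Proof.
elim: n => [|n [g gE]]; first by exists idfun.
by exists (f \o g) => x; rewrite /= gE.
Qed.

Lemma iter_commute (T : Type) (f g : T -> T) m n x :
  (forall x, g (f x) = f (g x)) -> iter m g (iter n f x) = iter n f (iter m g x).
Proof.
move=> gf; have gfn y : g (iter n f y) = iter n f (g y).
  by elim: n => //= n IH; rewrite gf IH.
by elim: m => //= m ->.
Qed.

(* A linear relation between the powers of f, divided by its lowest term. *)
Lemma power_factor X (f : {linear X -> X}) : fdm X ->
  exists (m : nat) (h : {linear X -> X}),
    (forall x, h (f x) = f (h x)) /\ forall x, iter m f x = iter m.+1 f (h x).
Proof.
move=> Xd; have [p pE] := choice (iter_linear f).
have [n [c [c0 cE]]] :=
  dependent_seq (fun i => (p i : homk X X)) (fdim_hom (fdm_fingen Xd) Xd).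
have ex0 : exists i, (i < n)%N && (c i != 0) by case: c0 => i; exists i; apply/andP.
case: (ex_minnP ex0) => m /andP[mn cm] mmin.
(* Here h is the sum over i > m of -(c_i / c_m) f^(i-m-1). For i <= m the truncated exponent is
   harmless, since [b i] is 0. *)
pose b i : C := if (m < i)%N then (- (c m)^-1 * c i)%:A else 0.
have [h hE] : exists h : {linear X -> X},
    forall x, h x = \sum_(i < n) b i *: iter (i - m.+1) f x.
  have bE i : exists g : {linear X -> X}, forall x, g x = b i *: iter (i - m.+1) f x.
    apply: linear_ex => a x y; rewrite -!pE linearP scalerDr !scalerA.
    congr (_ *: _ + _); rewrite /b; case: ifP => _; last by rewrite mulr0 mul0r.
    by rewrite -scalerAl -scalerAr mul1r mulr1.
  have [q qE] := choice bE; have [s sE] := ffun_sum_ex (fun i : 'I_n => q i).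
  have [d dE] := ffun_map_ex (fun i : 'I_n => (idfun : {linear X -> X})).
  exists (s \o d) => x; rewrite /= sE; apply: eq_bigr => i _.
  by rewrite qE dE ffunE.
exists m, h; split=> x.
  rewrite !hE linear_sum; apply: eq_bigr => i _.
  have bf y : f (b i *: y) = b i *: f y by rewrite linearZ.
  by rewrite bf -iterSr.
rewrite hE -(pE m.+1) linear_sum.
have -> : \sum_(i < n) p m.+1 (b i *: iter (i - m.+1) f x) =
    \sum_(i < n | (m < i)%N) (- (c m)^-1 * c i)%:A *: iter i f x.
  rewrite [RHS]big_mkcond; apply: eq_bigr => i _; rewrite linearZ /= pE -iterD /b.
  by case: ifP => mi; rewrite ?scale0r ?subnKC.
have: \sum_(i < n) (c i)%:A *: iter i f x = 0.
  transitivity ((\sum_(i < n) c i *: (p i : homk X X) : homk X X) x).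
    by rewrite homk_sumE; apply: eq_bigr => i _; rewrite pE.
  by rewrite cE.
rewrite (bigD1 (Ordinal mn)) //= (bigID (fun i : 'I_n => (m < i)%N)) /=.
rewrite [X in _ + (_ + X)]big1 => [|i /andP[im mi]]; last first.
  have -> : c i = 0; last by rewrite scale0r scale0r.
  apply/eqP; apply: contraTT mi => ci; rewrite negbK.
  have := mmin i; rewrite ltn_ord ci => /(_ isT).
  by rewrite leq_eqVlt => /orP[/eqP mi|//]; case/negP: im; apply/eqP/val_inj.
rewrite addr0 => /eqP; rewrite addr_eq0 => /eqP e.
have -> : iter m f x = ((c m)^-1)%:A *: ((c m)%:A *: iter m f x).
  by rewrite scalerA -scalerAl mul1r scalerA mulVf // !scale1r.
rewrite e scalerN scaler_sumr -sumrN; apply: eq_big => [i|i mi].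
  by apply/andb_idl => mi; apply: contraTneq mi => ->; rewrite ltnn.
by rewrite scalerA -scalerAl mul1r scalerA mulNr !scaleNr.
Qed.

(** From f^m = f^(m+1) h with h commuting with f, the power F = f^(m+1) satisfies F = F^2 g for g =
    h^(m+1), and e = F g is idempotent. The exponent is positive so that e has its image in that of
    f and kills the kernel of f. *)
Lemma fitting X (f : {linear X -> X}) : fdm X ->
  exists (m : nat) (e h : {linear X -> X}),
  [/\ forall x, e (e x) = e x, forall x, e x = iter m.+1 f (h x),
      forall x, e x = h (iter m.+1 f x)
    & forall x, iter m.+1 f (e x) = iter m.+1 f x].
Proof.
move=> /(power_factor f)[m [h [hf mh]]].
have [g gE] := iter_linear h m.+1; have [F FE] := iter_linear f m.+1.
have fh n x : iter m.+1 f x = iter (n + m.+1) f (iter n h x).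
  elim: n => // n IH; rewrite addSnnS iterD [iter n.+1 h x]iterS.
  have -> : iter m.+2 f (h (iter n h x)) = iter m.+1 f (iter n h x).
    by rewrite iterS -mh.
  by rewrite -iterD -IH.
have FF x : F (F (g x)) = F x by rewrite !FE gE -iterD -fh.
have gF x : g (F x) = F (g x) by rewrite !FE !gE; apply: iter_commute.
exists m, (F \o g), g; split=> x.
- by rewrite /= gF FF.
- by rewrite -FE.
- by rewrite -FE gF.
- by rewrite -!FE FF.
Qed.

Lemma inj_endo_bij X (f : {linear X -> X}) : fdm X -> injective f -> bijective f.
Proof.
move=> Xd fi; have [g gE] := kmod_lin f.
have /choice[h hE] : surj g.
  by apply: dim_inj_surj => // x y; rewrite !gE => /fi.
by exists h => [x|y]; [apply: fi|]; rewrite -gE hE.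
Qed.

Lemma local_end X (f : {linear X -> X}) : fdm X -> indecomposable X ->
  bijective f \/ exists n, forall x, iter n f x = 0.
Proof.
move=> Xd /indecP[X0 XP]; have [m [e [h [ee ef eh fe]]]] := fitting f Xd.
have [e0|e1] := XP e ee; last left.
  right; exists m.+1 => x; rewrite -fe e0.
  by have [F <-] := iter_linear f m.+1; rewrite linear0.
apply: inj_endo_bij => //; apply/inj_linearP => x fx.
rewrite -[LHS]e1 eh iterSr fx.
by have [F <-] := iter_linear f m; rewrite !linear0.
Qed.

(** Sums of nonunits in the local ring End X are nonunits. If f s^-1 is nilpotent and g x = 0, then
    f s^-1 fixes s x, so s x = 0 and g is injective. *)
Lemma local_end_add X (f g s : {linear X -> X}) : fdm X -> indecomposable X ->
  (forall x, f x + g x = s x) -> bijective s -> bijective f \/ bijective g.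
Proof.
move=> Xd Xi fgs [t st ts].
have [t' [t'E _]] : exists t' : {linear X -> X}, (forall x, s (t' x) = x) /\ True.
  have si : injective s := can_inj st.
  have [//|t' t'E] := @factor_inj _ _ _ _ s idfun si; first by move=> z; exists (t z).
  by exists t'.
have [fb|[n fn]] := local_end (f \o t') Xd Xi.
  left; apply: inj_endo_bij => //; apply/inj_linearP => x fx.
  have xE : x = t' (s x) by apply: (can_inj st); rewrite t'E.
  have sx0 : s x = 0 by apply: (bij_inj fb); rewrite /= -xE fx !linear0.
  by rewrite xE sx0 linear0.
right; apply: inj_endo_bij => //; apply/inj_linearP => x gx.
have fx : (f \o t') (s x) = s x.
  rewrite /=; have -> : t' (s x) = x by apply: (can_inj st); rewrite t'E.
  by rewrite -fgs gx addr0.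
have sx : s x = 0.
  by rewrite -(fn (s x)); elim: (n) => // j; rewrite iterS => <-.
by apply: (can_inj st); rewrite sx linear0.
Qed.

Lemma local_end_sum X n (f : 'I_n -> {linear X -> X}) (s : {linear X -> X}) :
  fdm X -> indecomposable X -> (forall x, \sum_i f i x = s x) -> bijective s ->
  exists i, bijective (f i).
Proof.
move=> Xd Xi; elim: n f s => [|n IH] f s fs sb.
  case: Xi => -[x /eqP x0]; case: x0; apply: (bij_inj sb).
  by rewrite -!fs !big_ord0.
have [r rE] : exists r : {linear X -> X}, forall x, r x = \sum_i f (lift ord0 i) x.
  apply: linear_ex => a x y; rewrite scaler_sumr -big_split /=.
  by apply: eq_bigr => i _; rewrite linearP.
have [|f0|rb] := @local_end_add _ (f ord0) r s Xd Xi _ sb.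
- by move=> x; rewrite rE -fs big_ord_recl.
- by exists ord0.
by have [i fi] := IH _ r (fun x => esym (rE x)) rb; exists (lift ord0 i).
Qed.

(** The exchange step of Krull-Schmidt: some term b_i a_i of the identity is an automorphism of X,
    and inverting it retracts Y_i onto X. *)
Lemma indec_retract_sum X n (Y : 'I_n -> lmodType C)
    (a : forall i, {linear X -> Y i}) (b : forall i, {linear Y i -> X}) :
  fdm X -> indecomposable X -> (forall x, \sum_i b i (a i x) = x) ->
  exists i, retract X (Y i).
Proof.
move=> Xd Xi ab.
have [|i [g gK _]] := @local_end_sum X n (fun i => b i \o a i) idfun Xd Xi ab.
  by exists id.
have ba_inj : injective (b i \o a i) := can_inj gK.
have [t st ts] := inj_endo_bij Xd ba_inj.
have [//|t' t'E] := @factor_inj _ _ _ _ (b i \o a i) idfun ba_inj.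
  by move=> z; exists (t z).
exists i, (a i), (t' \o b i) => x; apply: ba_inj.
exact: t'E.
Qed.

Lemma indec_retract_prod X Y Z : fdm X -> indecomposable X ->
  retract X (Y * Z)%type -> retract X Y \/ retract X Z.
Proof.
move=> Xd Xi [i [p ip]].
have [f fE] := fst_ex Y Z; have [s sE] := snd_ex Y Z.
have [l lE] := inl_ex Y Z; have [r rE] := inr_ex Y Z.
have [] := @local_end_add X (p \o (l \o (f \o i))) (p \o (r \o (s \o i))) idfun Xd Xi.
- move=> x; rewrite /= -linearD lE rE fE sE -[RHS]ip; congr (p _).
  by case: (i x) => y z; rewrite pairD addr0 add0r.
- by exists id.
- move=> fb; left.
  have [//|t tE] := @factor_inj _ _ _ _ _ idfun (bij_inj fb).
    by case: fb => g _ gK z; exists (g z).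
  exists (f \o i), (t \o (p \o l)) => x; apply: (bij_inj fb); exact: tE.
move=> fb; right.
have [//|t tE] := @factor_inj _ _ _ _ _ idfun (bij_inj fb).
  by case: fb => g _ gK z; exists (g z).
exists (s \o i), (t \o (p \o r)) => x; apply: (bij_inj fb); exact: tE.
Qed.

Lemma indec_retract_ffun X n Y : fdm X -> indecomposable X ->
  retract X {ffun 'I_n -> Y} -> retract X Y.
Proof.
move=> Xd Xi [i [p ip]].
have [q qE] := choice (@ffun_proj_ex _ 'I_n Y).
have jex (j : 'I_n) : exists w : {linear Y -> {ffun 'I_n -> Y}},
    forall y, w y = [ffun l => if l == j then y else 0].
  apply: linear_ex => a x y; apply/ffunP => l; rewrite !ffunE.
  by case: eqP => // _; rewrite scaler0 addr0.
have [w wE] := choice jex.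
have [] // := @indec_retract_sum X n (fun=> Y) (fun j => q j \o i) (fun j => p \o w j).
move=> x; rewrite /= -linear_sum -[RHS]ip; congr (p _); apply/ffunP => l.
rewrite sum_ffunE (bigD1 l) //= big1 => [|j jl].
  by rewrite wE ffunE eqxx qE addr0.
by rewrite wE ffunE eq_sym (negPf jl).
Qed.

Lemma indec_retract_iso X Y : nonzero X -> indecomposable Y -> retract X Y -> iso X Y.
Proof.
move=> [x x0] /indecP[_ YP] [i [p ip]].
have [y|e0|e1] := YP (i \o p); first by rewrite /= ip.
  by case/negP: x0; have := e0 (i x); rewrite /= ip => /(congr1 p); rewrite ip linear0 => ->.
by apply/isoP; exists i, p.
Qed.

(** Induction on the dimension in place of a decomposition into indecomposables; no families of
    summands have to be carried along. *)
Lemma fdm_ind (Phi : lmodType C -> Prop) :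
  (forall X Y, iso X Y -> Phi X -> Phi Y) ->
  (forall X, ~ nonzero X -> Phi X) ->
  (forall X, indecomposable X -> Phi X) ->
  (forall X Y, Phi X -> Phi Y -> Phi (X * Y)%type) ->
  forall X, fdm X -> Phi X.
Proof.
move=> Piso P0 P1 PM X; have [n] := ubnP (dimk (kmod X)).
elim: n X => // n IH X Xn Xd.
have [X0|X0] := pselect (nonzero X); last exact: P0.
have [Xi|] := pselect (indecomposable X); first exact: P1.
move=> /not_andP[//|/existsNP[Y /existsNP[Z /not_implyP[XYZ /contrapT[Y0 Z0]]]]].
apply: Piso (iso_sym XYZ) _.
have Yd : fdm Y by apply: fdm_retract Xd; apply/summandP; exists Z.
have Zd : fdm Z.
  apply: fdm_retract Xd; apply: retract_trans (retract_prodr Y Z) _.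
  exact/iso_retract/iso_sym.
have nz (W : lmodType C) : nonzero W -> fdm W -> (0 < dimk (kmod W))%N.
  move=> [w w0] /dimkP; rewrite lt0n; apply: contraPneq => -> [f fb].
  case/negP: w0; apply/eqP; apply: (bij_inj fb).
  by rewrite [LHS]thinmx0 [RHS]thinmx0.
have XE : dimk (kmod X) = (dimk (kmod Y) + dimk (kmod Z))%N.
  rewrite -(fdm_prod Yd Zd).2; apply: esym; apply: dimk_eq.
  apply: (dim_iso _ (dimkP Xd)).
  have /isoP[f [g [fg gf]]] := XYZ.
  have [f' f'E] := kmod_lin f; have [g' g'E] := kmod_lin g.
  by apply/isoP; exists f', g'; split=> x; rewrite f'E g'E.
have := nz _ Y0 Yd; have := nz _ Z0 Zd => Zp Yp.
rewrite ltnS XE in Xn.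
apply: PM; apply: IH => //; apply: leq_trans Xn.
  by rewrite -[ltnLHS]addn0 ltn_add2l.
by rewrite -[ltnLHS]add0n ltn_add2r.
Qed.
End KrullSchmidt.

(** * Minimal presentations and tau-rigidity *)

Section Presentations.
Context (k : fieldType) (C : algType k).
Implicit Types (X Y Z M P : lmodType C).

Lemma submod_exists M (W : {pred M}) : submod_closed W ->
  exists (U : lmodType C) (i : {linear U -> M}),
    injective i /\ forall v, v \in W <-> exists u, i u = v.
Proof.
case=> W0 WD; apply: (@sub_exists _ _ (fun v => v \in W)).
by split=> // a u v Wu Wv; exact: WD.
Qed.

(** Lift t g to v : P0 -> E. On P1 the map v f lands in the kernel of h and lifts through q to a
    power of Z. Extending the coordinates of that lift to P0 and subtracting their image under q
    from v leaves a map that kills the image of f, hence descends to M. *)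
Lemma hom_surj_relproj M Z P1 P0 (f : {linear P1 -> P0}) (g : {linear P0 -> M}) :
  min_proj_pres f g ->
  (forall u : {linear P1 -> Z}, exists v : {linear P0 -> Z}, forall x, u x = v (f x)) ->
  relproj M Z.
Proof.
move=> [[P1p P0p] gs gf _ _] uv E F I q h hs hq t.
have [v vE] := proj_lift (u := t \o g) P0p (fun x => hs _).
have [|w wE] := @proj_lift _ P1 _ _ q (v \o f) P1p.
  by move=> x; apply/hq; rewrite vE /= (gf (f x)).2 ?linear0 //; exists x.
have [r rE] := choice (fun i => ffun_proj_ex Z (i : I)).
have [s sE] := choice (fun i => uv (r i \o w)).
have [S SE] := ffun_map_ex s.
have [d dE] : exists d : {linear P0 -> E}, forall y, d y = v y - q (S y).
  by apply: linear_ex => a x y; rewrite !linearP /= addrACA -scalerDr.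
have [|l lE] := factor_surj (f := d) gs.
  move=> y /gf[x <-]; rewrite dE; apply/eqP; rewrite subr_eq0; apply/eqP.
  rewrite -[LHS]wE; congr (q _); apply/ffunP => i.
  by rewrite SE ffunE -sE /= rE.
exists l => m; have [y <-] := gs m; rewrite lE dE linearB vE.
by rewrite (hq (q _)).2 ?subr0 //; exists (S y).
Qed.

(* Lifting the identity of M to the pushout of u along f extends u up to a map w with
   w P1 = w (ker f); as ker f is superfluous in P1, such a w is zero. *)
Lemma relproj_hom_surj M Z P1 P0 (f : {linear P1 -> P0}) (g : {linear P0 -> M}) :
  min_proj_pres f g -> relproj M Z ->
  forall u : {linear P1 -> Z}, exists v : {linear P0 -> Z}, forall x, u x = v (f x).
Proof.
move=> [[P1p P0p] gs gf _ fsup] Mp u.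
have [E [p [ps pE]]] : exists (E : lmodType C) (p : {linear (P0 * Z)%type -> E}),
    surj p /\ forall v, (exists x, v = (f x, - u x)) <-> p v = 0.
  apply: quot_exists; split=> [|a _ _ [x ->] [y ->]].
    by exists 0; rewrite !linear0.
  by exists (a *: x + y); rewrite !linearP.
have [fs fsE] := fst_ex P0 Z.
have [|gE gEE] := factor_surj (f := g \o fs) ps.
  by move=> v /pE[x ->]; rewrite /= fsE; apply/gf; exists x.
have gEs : surj gE.
  by move=> m; have [y <-] := gs m; exists (p (y, 0)); rewrite gEE /= fsE.
have [j jE] := inr_ex P0 Z; have [l lE] := inl_ex P0 Z.
have pj x : p (f x, 0) = p (0, u x).
  apply/eqP; rewrite -subr_eq0 -linearB; apply/eqP/pE; exists x.
  by rewrite pairB subr0 add0r.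
have pD y z : p (y, z) = p (y, 0) + p (0, z).
  by rewrite -linearD pairD addr0 add0r.
have kerP e : gE e = 0 <-> exists z, p (j z) = e.
  split=> [|[z <-]]; last by rewrite gEE /= fsE jE linear0.
  have [[y z] <-] := ps e; rewrite gEE /= fsE /= => /gf[x <-].
  by exists (u x + z); rewrite jE (pD (f x)) pj -linearD pairD addr0.
have [r rE] := ffun_proj_ex Z (@ord0 0).
have [|s sE] := Mp _ _ _ (p \o (j \o r)) gE gEs _ idfun.
  move=> e; rewrite kerP; split=> -[z <-]; last by exists (r z).
  by exists [ffun=> z]; rewrite /= rE ffunE.
(* Two maps P0 -> E lie over g: the canonical one and the one through the section s. Their
   difference lands in the image of Z and lifts to v. *)
have [t tE] : exists t : {linear P0 -> E}, forall y, t y = p (y, 0) - s (g y).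
  have [t tE] : exists t : {linear P0 -> E}, forall y, t y = p (l y) - s (g y).
    by apply: linear_ex => a x y; rewrite !linearP /= addrACA -scalerDr.
  by exists t => y; rewrite tE lE.
have [|v vE] := @proj_lift _ _ _ _ (p \o j) t P0p.
  by move=> y; apply/kerP; rewrite tE linearB sE gEE /= fsE subrr.
exists v; have [w wE] : exists w : {linear P1 -> Z}, forall x, w x = u x - v (f x).
  by apply: linear_ex => a x y; rewrite !linearP /= addrACA -scalerDr.
suff w0 x : w x = 0 by move=> x; apply/eqP; rewrite -subr_eq0 -wE w0.
suff /eqP : x \in [pred x | w x == 0] by [].
move: x; apply: fsup.
  split=> [|a x y]; rewrite !inE ?linear0 // => /eqP wx /eqP wy.
  by rewrite linearP wx wy scaler0 addr0.
move=> x.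
(* In the pushout v (f x) and u x become equal. This gives x' in the kernel of f with u x' = w x,
   hence w x' = w x, and x is x' plus an element of the kernel of w. *)
have [x' x'E] : exists x', (0, v (f x) - u x) = (f x', - u x').
  apply/pE; have -> : (0, v (f x) - u x) = j (v (f x)) - (0, u x).
    by rewrite jE pairB subr0.
  have vE' y : p (j (v y)) = t y := vE y.
  have gfx : g (f x) = 0 by apply/gf; exists x.
  by rewrite linearB vE' tE pj gfx linear0 subr0 subrr.
case: x'E => fx' ux'.
exists (x - x'), x'; split=> //; last by rewrite subrK.
rewrite inE linearB !wE -fx' linear0 subr0 subr_eq0; apply/eqP.
by rewrite -[LHS]opprB ux' opprK.
Qed.

Hypothesis Cd : fdim (C : lmodType k).

(* Take P -> M with P of least dimension. If W + ker = P, then P has an endomorphism f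
   over M with image in W. By Fitting some f^n h with n > 0 is an idempotent over M, and
   it is onto because its image is a projective mapping onto M. *)
Lemma proj_cover_exists M : fdm M -> exists P (g : {linear P -> M}),
  [/\ proj P, surj g & superfluous (fun y => g y = 0)].
Proof.
move=> Md; pose D n := `[< exists P (g : {linear P -> M}),
  [/\ proj P, surj g & dimk (kmod P) = n] >].
have ex0 : exists n, D n.
  have /fingenP[m [g gs]] := fdm_fingen Md.
  exists (dimk (kmod {ffun 'I_m -> C^o})); apply/asboolP.
  by exists {ffun 'I_m -> C^o}, g; split=> //; exact: free_proj.
case: (ex_minnP ex0) => n /asboolP[P [g [Pp gs Pn]]] nmin.
exists P, g; split=> // W Wc WK.
have Pd : fdm P := fingen_fdm Cd Pp.1.
have [U [i [ii iW]]] := submod_exists Wc.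
have gis : surj (g \o i).
  move=> m; have [x <-] := gs m; have [w [y [/iW[u <-] gy ->]]] := WK x.
  by exists u; rewrite linearD gy addr0.
have [h hE] := Pp.2 _ _ (g \o i) g gis.
have [m [e [t [ee et te te']]]] := fitting (i \o h) Pd.
have gI y l : g (iter l (i \o h) y) = g y by elim: l => //= l <-; exact: hE.
have ge x : g (e x) = g x by rewrite -(gI _ m.+1) te' gI.
have [K [j [p [ji ps jp]]]] := im_exists e.
have pj : cancel j p.
  by move=> y; apply: ji; have [x <-] := ps y; rewrite !jp ee.
have Kp : proj K by apply: retract_proj Pp; exists j, p.
have gjs : surj (g \o j).
  by move=> z; have [x <-] := gs z; exists (p x); rewrite /= jp ge.
have [j' j'E] := kmod_lin j.
have j's : surj j'.
  apply: dim_inj_surj => //; first by move=> x y; rewrite !j'E => /ji.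
  by rewrite Pn; apply: nmin; apply/asboolP; exists K, (g \o j).
move=> x; have [y <-] := j's x; have [z <-] := ps y.
by rewrite j'E jp et; apply/iW; eexists.
Qed.

Lemma min_pres_exists M : fdm M ->
  exists P1 P0 (f : {linear P1 -> P0}) (g : {linear P0 -> M}), min_proj_pres f g.
Proof.
move=> Md; have [P0 [g [P0p gs gsup]]] := proj_cover_exists Md.
have [K [i [ii iE]]] := ker_exists g.
have [|P1 [q [P1p qs qsup]]] := @proj_cover_exists K.
  by have [] := fdm_inj ii (fingen_fdm Cd P0p.1).
exists P1, P0, (i \o q), g; split=> //.
  move=> y; rewrite iE; split=> -[u <-]; last by exists (q u).
  by have [x <-] := qs u; exists x.
move=> W Wc WK; apply: qsup Wc _ => x; have [w [y [Ww fy ->]]] := WK x.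
by exists w, y; split=> //; apply: ii; rewrite linear0.
Qed.

(** The image of the tensor of h and m under the canonical map from [star P] tensor Z to Hom(P,
    Z). *)
Lemma balanced_ex P Z (h : star P) (m : Z) :
  exists u : homk P Z, forall x, (u : Hom _ _) x = ((h : Hom _ _) x : C) *: m.
Proof.
suff [u uE] : exists u : {linear P -> Z}, forall x, u x = ((h : Hom _ _) x : C) *: m.
  by exists u.
by apply: linear_ex => a x y; rewrite linearP scalerDl scalerA.
Qed.

Lemma star_sumE P (I : finType) (a : I -> C^c) (h : I -> star P) x :
  ((\sum_i a i *: h i : star P) : Hom _ _) x = \sum_i (h i : Hom _ _) x * (a i : C) :> C.
Proof.
pose ev (g : star P) : C := (g : Hom _ _) x.
rewrite -[LHS]/(ev _) (big_morph ev (id1 := 0) (op1 := +%R)) //.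
Qed.

Lemma star_basis P n (x : 'I_n -> P) (h : 'I_n -> {linear P -> C^o}) :
  (forall y, y = \sum_i h i y *: x i) ->
  forall g : star P, g = \sum_i (((g : Hom _ _) (x i) : C) : C^c) *: (h i : star P).
Proof.
move=> xE g; apply: HomP => y; rewrite star_sumE {1}(xE y) linear_sum.
by apply: eq_bigr => i _; rewrite linearZ.
Qed.

(** * Hom(Z, D Tr M) as the dual of the cokernel of Hom(f, Z) *)

Section Transpose.
Context (M Z P1 P0 : lmodType C) (f : {linear P1 -> P0}) (X : lmodType C^c)
  (p : {linear star P1 -> X}).
Hypotheses (P1p : proj P1) (P0p : proj P0) (ps : surj p).
Hypothesis pE : forall h : star P1, p h = 0 <->
  exists h' : star P0, forall x, (h : Hom _ _) x = (h' : Hom _ _) (f x).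

Lemma dual_eval (h : {linear Z -> dual X}) (a : C) (m : Z) (x : X) :
  (h (a *: m) : Hom _ _) x = (h m : Hom (restr (@in_algc k C) X) k^o) ((a : C^c) *: x).
Proof. by rewrite linearZ. Qed.

(** Hom(Z, D X) is dual to X tensor Z, which is the cokernel of Hom(P0, Z) -> Hom(P1, Z) since P0
    and P1 are finitely generated projective. Tensors are written out in dual bases, and [beta] is
    the pairing of Z with [star P1] that h defines. *)
Lemma hom_surj_dual :
  (forall u : {linear P1 -> Z}, exists v : {linear P0 -> Z}, forall x, u x = v (f x)) ->
  ~ hom_nonzero Z (dual X).
Proof.
move=> uv [h [m /eqP]]; apply; apply: HomP => x0; have [h0 <-] := ps x0.
have [n1 [x [b xE]]] := proj_basis P1p; have [n0 [y [c yE]]] := proj_basis P0p.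
pose beta (m : Z) (g : star P1) : k := (h m : Hom (restr (@in_algc k C) X) k^o) (p g).
have betaZ a z g : beta (a *: z) g = beta z ((a : C^c) *: g).
  by rewrite /beta dual_eval linearZ.
have beta_sum z (I : finType) (G : I -> star P1) :
    beta z (\sum_i G i) = \sum_i beta z (G i).
  rewrite /beta linear_sum; exact: (linear_sum (h z : Hom (restr (@in_algc k C) X) k^o)).
have beta_suml (I : finType) (z : I -> Z) g :
    beta (\sum_i z i) g = \sum_i beta (z i) g.
  apply: (big_morph (beta^~ g)) => [u v|]; first by rewrite /beta linearD.
  by rewrite /beta linear0.
rewrite -[LHS]/(beta m h0) (star_basis xE h0) beta_sum.
have [u uE] := balanced_ex h0 m; have [v vE] := uv u.
transitivity (\sum_i beta (u (x i)) (b i : star P1)).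
  by apply: eq_bigr => i _; rewrite uE betaZ.
(* Expand v (f x_i) in the dual basis of P0 and move the coefficients to the other argument. Summed
   over i, they assemble c_j f, which p kills. *)
transitivity (\sum_i \sum_j beta (v (y j)) (((c j (f (x i)) : C) : C^c) *: (b i : star P1))).
  apply: eq_bigr => i _; rewrite vE (yE (f (x i))) linear_sum beta_suml.
  by apply: eq_bigr => j _; rewrite linearZ betaZ -yE.
rewrite exchange_big; apply: big1 => j _; rewrite -beta_sum.
have <- := star_basis xE ((c j \o f : {linear P1 -> C^o}) : star P1).
rewrite /beta; have -> : p ((c j \o f : {linear P1 -> C^o}) : star P1) = 0.
  by apply/pE; exists (c j).
exact: (linear0 (h (v (y j)) : Hom (restr (@in_algc k C) X) k^o)).
Qed.

(** A functional l that kills the maps factoring through f defines a map Z -> D X, sending m to the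
    functional p h |-> l (h(-) m). If that map is zero then so is l, because the maps h(-) m span
    Hom(P1, Z) by the dual basis. *)
Lemma dual_hom_surj : fdm Z -> ~ hom_nonzero Z (dual X) ->
  forall u : {linear P1 -> Z}, exists v : {linear P0 -> Z}, forall x, u x = v (f x).
Proof.
move=> Zd hZ; have [fs fsE] := @precomp_ex _ _ _ _ Z f.
suff fss : surj fs by move=> u; have [v vu] := fss u; exists v => x; rewrite -fsE vu.
apply: contrapT => /(functional_coker (fdim_hom P1p.1 Zd))[l [u [lu lf]]].
have [n1 [x [b xE]]] := proj_basis P1p.
have [theta thetaE] := choice (fun hm : star P1 * Z => balanced_ex hm.1 hm.2).
have phi_ex (m : Z) : exists phi : dual X, forall h : star P1,
    (phi : Hom (restr (@in_algc k C) X) k^o) (p h) = l (theta (h, m)).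
  have [t tE] : exists t : {linear restr (@in_algc k C) (star P1) -> k^o},
      forall h : star P1, t h = l (theta (h, m)).
    apply: (@linear_ex k (restr (@in_algc k C) (star P1)) k^o) => a g h.
    rewrite -linearP; congr (l _); apply: HomP => z.
    rewrite homkD homkZ !thetaE scalerA -scalerDl; congr (_ *: _).
    by rewrite -[RHS]/(a%:A * (g : Hom _ _) z + (h : Hom _ _) z) -alg_comm.
  have [q qE] : exists q : {linear restr (@in_algc k C) (star P1) -> restr (@in_algc k C) X},
      forall h : star P1, q h = p h.
    apply: (@linear_ex k (restr (@in_algc k C) (star P1)) (restr (@in_algc k C) X)) => a g h.
    exact: linearP.
  have qs : surj q by move=> z; have [h <-] := ps z; exists h; rewrite qE.
  have [|phi phiE] := factor_surj (f := t) qs.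
    move=> h; rewrite qE tE => /pE[h' hE].
    have [v vE] := balanced_ex h' m; rewrite -(lf v); congr (l _); apply: HomP => z.
    by rewrite fsE vE thetaE hE.
  by exists phi => h; rewrite -qE phiE tE.
have [phi phiE] := choice phi_ex.
have [w wE] : exists w : {linear Z -> dual X}, forall m, w m = phi m.
  apply: linear_ex => a m1 m2; apply: HomP => z; have [h <-] := ps z.
  transitivity ((phi m1 : Hom (restr (@in_algc k C) X) k^o) ((a : C^c) *: p h) +
    (phi m2 : Hom (restr (@in_algc k C) X) k^o) (p h)); last by [].
  rewrite -linearZ !phiE -linearD; congr (l _); apply: HomP => y.
  by rewrite homkD !thetaE /= scalerDr scalerA.
apply: hZ; exists w.
apply: contrapT => /forallNP w0.
have phi0 m : phi m = 0.
  by rewrite -wE; apply/eqP; apply: contrapT => /negP; exact: w0.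
move/eqP: lu; apply/negP; rewrite eq_sym.
suff -> : l u = 0 by rewrite oner_eq0.
have -> : u = \sum_i theta (b i : star P1, (u : Hom _ _) (x i)).
  apply: HomP => z; pose ev (g : homk P1 Z) : Z := (g : Hom _ _) z.
  rewrite -[RHS]/(ev _) (big_morph ev (id1 := 0) (op1 := +%R)) //.
  rewrite {1}(xE z) linear_sum; apply: eq_bigr => i _.
  by rewrite linearZ /ev thetaE.
rewrite linear_sum big1 // => i _.
by rewrite -phiE phi0.
Qed.
End Transpose.

(** From left to right any presentation that comes with the translate will do; from right to left
    one is constructed, with the transpose as a quotient of [star P1]. *)
Lemma tau_rigidP M : fdm M -> tau_rigid M <-> relproj M M.
Proof.
move=> Md; split=> [[N [X [P1 [P0 [f [g [mp [p ps pE]]]]]] NX] hN]|Mp].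
  have [[P1p P0p] _ _ _ _] := mp.
  apply: hom_surj_relproj mp _; apply: (dual_hom_surj P1p ps pE Md).
  have /isoP[s [t [st ts]]] := NX.
  move=> [h [x hx]]; apply: hN; exists (t \o h), x.
  by apply: contraNneq hx => /= /(congr1 s); rewrite ts linear0 => ->.
have [P1 [P0 [f [g mp]]]] := min_pres_exists Md.
have [[P1p P0p] _ _ _ _] := mp.
have [X [p [ps pE]]] : exists (X : lmodType C^c) (p : {linear star P1 -> X}),
    surj p /\ forall h : star P1, (exists h' : star P0,
      forall x, (h : Hom _ _) x = (h' : Hom _ _) (f x)) <-> p h = 0.
  apply: quot_exists; split=> [|a u v [u' uE] [v' vE]]; first by exists 0.
  by exists (a *: u' + v') => x; rewrite /= /star_fun /= uE vE.
exists (dual X).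
  exists X; last exact: iso_refl.
  by exists P1, P0, f, g; split=> //; exists p => // h; rewrite pE.
apply: (hom_surj_dual P1p P0p ps) (relproj_hom_surj mp Mp).
by move=> h; rewrite pE.
Qed.
End Presentations.

(** * Counting indecomposable summands *)

Section Counting.
Context (k : fieldType) (C : algType k).
Implicit Types (X Y Z M P S : lmodType C).

Lemma match_exists a b (X : 'I_a -> lmodType C) (Y : 'I_b -> lmodType C) :
  (forall i j, iso (X i) (X j) -> i = j) ->
  (forall i, exists j, iso (X i) (Y j)) ->
  exists s : 'I_a -> 'I_b, injective s /\ forall i, iso (X i) (Y (s i)).
Proof.
move=> Xi /choice[s sE]; exists s; split=> // i j e; apply: Xi.
by apply: iso_trans (sE i) _; rewrite e; exact: iso_sym.
Qed.

Lemma card_ind_uniq M n m : card_ind M n -> card_ind M m -> n = m.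
Proof.
have le n1 m1 : card_ind M n1 -> card_ind M m1 -> (n1 <= m1)%N.
  move=> [X [XM Xi _]] [Y [_ _ MY]].
  have [//|s [si _]] := @match_exists _ _ X Y Xi.
    by move=> i; have [Xii XMi] := XM i; exact: MY.
  by have := leq_card s si; rewrite !card_ord.
by move=> Mn Mm; apply/eqP; rewrite eqn_leq !le.
Qed.

Lemma card_ind_iso M N n : iso M N -> card_ind M n -> card_ind N n.
Proof.
move=> MN [X [XM Xi MX]]; exists X; split=> // [i|Y Yi /summandP YN].
  have [Xii /summandP XMi] := XM i; split=> //; apply/summandP.
  exact: retract_trans XMi (iso_retract MN).
by apply: MX => //; apply/summandP; exact: retract_trans YN (iso_retract (iso_sym MN)).
Qed.

Lemma card_ind_prodS M S n : fdm M -> fdm S -> indecomposable S -> ~ retract S M ->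
  card_ind M n -> card_ind (M * S)%type n.+1.
Proof.
move=> Md Sd Si SM [X [XM Xi MX]].
exists (fun i => oapp X S (unlift ord0 i)); split.
- move=> i; case: unliftP => [j|] _ /=; last first.
    by split=> //; apply/summandP; exact: retract_prodr.
  have [Xii /summandP XMi] := XM j; split=> //.
  by apply/summandP; exact: retract_trans XMi (retract_prodl M S).
- move=> i j; case: unliftP => [i'|] ->; case: unliftP => [j'|] -> //=.
  + by move=> /Xi ->.
  + move=> XS; case: SM; apply: retract_trans (iso_retract (iso_sym XS)) _.
    by apply/summandP; have [] := XM i'.
  + move=> XS; case: SM; apply: retract_trans (iso_retract XS) _.
    by apply/summandP; have [] := XM j'.
move=> Y Yi /summandP YMS.
have Yd : fdm Y by apply: fdm_retract YMS _; have [] := fdm_prod Md Sd.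
have [YM|YS] := indec_retract_prod Yd Yi YMS.
  have [|i Yi'] := MX Y Yi; first exact/summandP.
  by exists (lift ord0 i); rewrite liftK.
by exists ord0; rewrite unlift_none; exact: indec_retract_iso Yi.1 Si YS.
Qed.

Lemma card_ind_prod_inv M S m : fdm M -> fdm S -> indecomposable S ->
  ~ retract S M -> card_ind (M * S)%type m ->
  exists2 n, m = n.+1 & card_ind M n.
Proof.
move=> Md Sd Si SM [X [XM Xi MX]].
have [|i0 SX] := MX S Si; first by apply/summandP; exact: retract_prodr.
case: m X XM Xi MX i0 SX => [X _ _ _ []//|n] X XM Xi MX i0 SX.
exists n => //; exists (fun i => X (lift i0 i)); split.
- move=> i; have [Xii /summandP XMi] := XM (lift i0 i); split=> //; apply/summandP.
  have Xd : fdm (X (lift i0 i)).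
    by apply: fdm_retract XMi _; have [] := fdm_prod Md Sd.
  have [//|XS] := indec_retract_prod Xd Xii XMi.
  have XiS := indec_retract_iso Xii.1 Si XS.
  by have /Xi/eqP := iso_trans XiS SX; rewrite eq_sym (negPf (neq_lift _ _)).
- by move=> i j /Xi/lift_inj.
move=> Y Yi /summandP YM.
have [|i Yi'] := MX Y Yi.
  by apply/summandP; exact: retract_trans YM (retract_prodl M S).
case: (unliftP i0 i) Yi' => [j ->|->]; first by exists j.
move=> YX; case: SM; apply: retract_trans YM; apply: iso_retract.
exact: iso_trans SX (iso_sym YX).
Qed.
End Counting.

(** * Independence of the functions dim Hom(X_i, -) and the bound on tau-rigid pairs *)

Section Rank.
Import Order.TTheory Num.Theory.
Context (k : fieldType) (C : algType k).
Implicit Types (X Y Z M P S : lmodType C).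

Lemma hd_iso X Y Z : iso X Y -> hd X Z = hd Y Z.
Proof.
move=> /isoP[f [g [fg gf]]].
have [F FE] := @precomp_ex _ _ _ _ Z f; have [G GE] := @precomp_ex _ _ _ _ Z g.
have FG : iso (homk Y Z) (homk X Z).
  by apply/isoP; exists F, G; split=> h; apply: HomP => x; rewrite ?FE ?GE ?FE ?fg ?gf.
rewrite /hd /dimk; case: pselect => [h|h]; case: pselect => [h'|h'] //.
- case: cid => n /= Hn; case: cid => n' /= Hn'; apply: (dim_uniq Hn).
  exact: dim_iso FG Hn'.
- by case: h'; case: h => n Hn; exists n; apply: dim_iso Hn; exact: iso_sym.
by case: h; case: h' => n Hn; exists n; apply: dim_iso Hn.
Qed.

Lemma hd_prod X Y Z : fingen X -> fingen Y -> fdm Z ->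
  hd (X * Y)%type Z = (hd X Z + hd Y Z)%N.
Proof.
move=> Xf Yf Zd.
have [l lE] := inl_ex X Y; have [r rE] := inr_ex X Y.
have [f fE] := fst_ex X Y; have [s sE] := snd_ex X Y.
have [F FE] := @precomp_ex _ _ _ _ Z f; have [S SE] := @precomp_ex _ _ _ _ Z s.
have [L LE] := @precomp_ex _ _ _ _ Z l; have [R RE] := @precomp_ex _ _ _ _ Z r.
rewrite /hd; have [|||||_ -> //] := @dim_exact _ _ _ _ F R.
- move=> u v /(congr1 L) e; apply: HomP => x; move: (congr1 (fun w : Hom _ _ => w x) e).
  by rewrite !LE !FE lE fE.
- by move=> h; exists (S h); apply: HomP => y; rewrite RE SE rE sE.
- move=> h; split=> [Rh|[u <-]]; last by apply: HomP => y; rewrite RE FE rE fE linear0.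
  exists (L h); apply: HomP => -[x y]; rewrite FE LE fE lE /=.
  rewrite -[y in RHS]add0r -[x in RHS]addr0 -pairD linearD.
  have -> : (h : Hom _ _) (0, y) = 0 by rewrite -rE -RE Rh.
  by rewrite addr0.
- exact: fdim_hom.
exact: fdim_hom.
Qed.

Lemma hd_eq0 X Z : ~ hom_nonzero X Z -> hd X Z = 0%N.
Proof.
move=> XZ; apply: dimk_eq; have [n nE] := null_ex (homk X Z) 'rV[k]_0.
exists n; exists (fun=> 0) => [f|u]; last by rewrite [LHS]thinmx0 [RHS]thinmx0.
apply: HomP => x; apply/esym/eqP; apply: contrapT => /negP fx.
by apply: XZ; exists f, x.
Qed.

Lemma span_ex (V : lmodType k) : fdim V -> exists d (e : 'I_d -> V),
  forall v, exists c : nat -> k, v = \sum_(l < d) c l *: e l.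
Proof.
move=> [d /isoP[f [g [fg gf]]]].
exists d, (fun l => g (delta_mx 0 l)) => v.
exists (fun l => if insub l is Some l' then f v 0 l' else 0).
rewrite -{1}(fg v) {1}(row_sum_delta (f v)) linear_sum; apply: eq_bigr => l _.
by rewrite linearZ insubT //= => ?; congr (f v 0 _ *: _); apply: val_inj.
Qed.

Lemma Fac_power (I : finType) M : Fac M {ffun I -> M}.
Proof.
have [g gE] : exists g : {linear {ffun 'I_#|I| -> M} -> {ffun I -> M}},
    forall z, g z = [ffun i => z (enum_rank i)].
  by apply: linear_ex => a x y; apply/ffunP => i; rewrite !ffunE.
exists #|I|, g => x; exists [ffun i => x (enum_val i)].
by rewrite gE; apply/ffunP => i; rewrite !ffunE enum_rankK.
Qed.

Lemma indec_retract_sum_fin X (I : finType) (Y : I -> lmodType C)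
    (a : forall i, {linear X -> Y i}) (b : forall i, {linear Y i -> X}) :
  fdm X -> indecomposable X -> (forall x, \sum_i b i (a i x) = x) ->
  exists i, retract X (Y i).
Proof.
move=> Xd Xi ab.
suff [i Xi'] : exists i : 'I_#|I|, retract X (Y (enum_val i)) by exists (enum_val i).
apply: (indec_retract_sum (a := fun i => a (enum_val i))
  (b := fun i => b (enum_val i)) Xd Xi) => x.
rewrite -[RHS]ab (reindex (@enum_val I (mem I))) //.
exact/onW_bij/enum_val_bij.
Qed.

(** The number r is the rank of Hom(W, f), whose kernel is Hom(W, K). The image of i may be smaller
    than the kernel of f, as long as maps from W into that kernel factor through i. *)
Lemma hom_rank (W K E F : lmodType C) (i : {linear K -> E}) (f : {linear E -> F}) :
  fingen W -> fdm K -> fdm E -> fdm F -> injective i ->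
  (forall x, f (i x) = 0) ->
  (forall u : {linear W -> E}, (forall x, f (u x) = 0) ->
    forall x, exists y, i y = u x) ->
  exists r, [/\ hd W E = (hd W K + r)%N, (r <= hd W F)%N &
    (hd W F <= r)%N <-> forall v : {linear W -> F}, exists u : {linear W -> E},
      forall x, f (u x) = v x].
Proof.
move=> Wf Kd Ed Fd ii fi fu.
have [I IE] := @postcomp_ex _ _ _ _ W i; have [G GE] := @postcomp_ex _ _ _ _ W f.
have [R [j [p [ji ps jp]]]] := im_exists G.
have [Rd Rle] := fdim_inj ji (fdim_hom Wf Fd).
exists (dimk R); split=> //.
  have [|||||_ //] := @dim_exact _ _ _ _ I p => //; last exact: fdim_hom.
    by move=> u v e; apply: HomP => x; apply: ii; rewrite -!IE e.
  move=> u; split=> [pu|[v <-]]; last first.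
    apply: ji; rewrite jp linear0; apply: HomP => x; rewrite GE IE fi //.
  have [x|v vE] := factor_inj (f := (u : Hom _ _)) ii.
    by apply: fu => y; rewrite -GE -jp pu linear0.
  by exists v; apply: HomP => x; rewrite IE.
split=> [FR v|vu].
  have [r rE] := dim_inj_surj ji (fdim_hom Wf Fd) FR v.
  have [u uE] := ps r; exists u => x; rewrite -GE -jp uE rE.
  by [].
have js : surj j.
  by move=> v; have [u uE] := vu v; exists (p u); apply: HomP => x; rewrite jp GE uE.
by have [] := fdim_surj js Rd.
Qed.

(** K is the trace of M in the kernel of f, the sum of the images of finitely many maps spanning
    Hom(M, ker f). Passing from the kernel to its trace brings it into Fac M and loses no map from a
    summand of M. *)
Lemma kernel_trace (M E F : lmodType C) (f : {linear E -> F}) : fdm M -> fdm E ->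
  exists (K : lmodType C) (i : {linear K -> E}),
  [/\ injective i, Fac M K, forall x, f (i x) = 0 &
    forall X (u : {linear X -> E}), retract X M -> (forall x, f (u x) = 0) ->
      forall x, exists y, i y = u x].
Proof.
move=> Md Ed; have [G GE] := @postcomp_ex _ _ _ _ M f.
have [N [j [ji jE]]] := ker_exists G.
have [d [e eE]] := span_ex (fdim_sub ji (fdim_hom (fdm_fingen Md) Ed)).
have [q qE] := ffun_sum_ex (fun l => (j (e l) : Hom _ _)).
have [K [i [p [ii ps ip]]]] := im_exists q.
exists K, i; split=> //.
- by exists d, p.
- move=> y; have [x <-] := ps y; rewrite ip qE linear_sum big1 // => l _.
  have /(congr1 (fun w : Hom _ _ => w (x l))) : G (j (e l)) = 0 by apply/jE; exists (e l).
  by rewrite GE.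
move=> X u [s [t st]] fu x.
have [w wE] : exists w, j w = (u \o t : {linear M -> E}).
  by apply/jE; apply: HomP => y; rewrite GE /= fu.
have [c cE] := eE w.
exists (p [ffun l : 'I_d => (c l)%:A *: s x]); rewrite ip qE.
transitivity ((j w : Hom _ _) (s x)); last by rewrite wE /= st.
rewrite cE linear_sum; under [in RHS]eq_bigr => l _ do rewrite linearZ.
by rewrite homk_sumE; apply: eq_bigr => l _; rewrite ffunE linearZ.
Qed.

(* If a i0 > 0, let F : M^I -> X i0 be a right approximation by the X j with a j < 0,
   and let K be the trace of M in ker F. The relation, evaluated at K, M^I and X i0,
   says that the dimensions of coker Hom(X j, F), weighted by a j, sum to zero; the
   negative weights do not contribute, so the identity of X i0 lifts through F. *)
Lemma hom_independent M m (X : 'I_m -> lmodType C) (a : 'I_m -> rat) :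
  fdm M -> (forall i, indecomposable (X i) /\ retract (X i) M) ->
  (forall i j, iso (X i) (X j) -> i = j) ->
  (forall Z, fdm Z -> Fac M Z -> \sum_i a i * (hd (X i) Z)%:R = 0) ->
  forall i, a i <= 0.
Proof.
move=> Md XM Xinj aZ i0; rewrite leNgt; apply/negP => ai0.
have Xd i : fdm (X i) by apply: fdm_retract Md; have [] := XM i.
have Xf i : fingen (X i) := fdm_fingen (Xd i).
have XFac i : Fac M (X i).
  by have [_ /retract_surj[p ps]] := XM i; apply: Fac_surj ps (Fac_refl M).
pose J := {j : 'I_m | a j < 0}.
have [|d dP] := @choice J nat (fun j d => exists e : 'I_d -> homk (X (val j)) (X i0),
    forall v, exists c : nat -> k, v = \sum_(l < d) c l *: e l).
  by move=> j; exact: span_ex (fdim_hom (Xf _) (Xd _)).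
pose e (j : J) := projT1 (cid (dP j)).
have eP j v : exists c : nat -> k, v = \sum_(l < d j) c l *: e j l.
  by rewrite /e; case: cid => /= e' /(_ v).
pose I := {j : J & 'I_(d j)}.
pose s (j : J) := projT1 (cid (XM (val j)).2).
have sP (j : J) : exists t : {linear M -> X (val j)}, cancel (s j) t.
  by rewrite /s; case: cid.
pose t (j : J) := projT1 (cid (sP j)).
have st (j : J) : cancel (s j) (t j) by rewrite /t; case: cid.
have [F FE] := ffun_sum_ex (fun p : I => (e (tag p) (tagged p) : Hom _ _) \o t (tag p)).
have Ed : fdm {ffun I -> M} by apply: fdm_ffun.
have [K [i [ii KFac fi iu]]] := kernel_trace F Md Ed.
have [Kd _] := fdm_inj ii Ed.
have [r rP] := choice (fun j : 'I_m => @hom_rank (X j) K _ _ i F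
  (Xf j) Kd Ed (Xd i0) ii fi (fun u => iu _ u (XM j).2)).
(* The dimension of the cokernel of Hom(X_j, F). *)
pose def (j : 'I_m) : rat := (hd (X j) (X i0))%:R - (r j)%:R.
have def_ge0 j : 0 <= def j by rewrite subr_ge0 ler_nat; have [] := rP j.
have sum0 : \sum_j a j * def j = 0.
  transitivity (\sum_j a j * (hd (X j) (X i0))%:R -
    (\sum_j a j * (hd (X j) {ffun I -> M})%:R - \sum_j a j * (hd (X j) K)%:R)).
    rewrite -!sumrB; apply: eq_bigr => j _; have [-> _ _] := rP j.
    by rewrite -!mulrBr natrD /def; congr (_ * (_ - _)); rewrite addrC addKr.
  by rewrite !aZ // ?subr0 //; exact: Fac_power.
have def_neg j : a j < 0 -> def j = 0.
  move=> aj; apply/eqP; rewrite eq_le def_ge0 andbT subr_le0 ler_nat.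
  have [_ _ ->] := rP j; move=> v.
  pose j' : J := exist (fun j => is_true (a j < 0)) j aj.
  have [c cE] := eP j' (v : homk (X j) (X i0)).
  (* The block of M^I belonging to j receives the coordinates of v along the spanning maps, and F
     adds them up to v again. *)
  have [u uE] : exists u : {linear X j -> {ffun I -> M}}, forall x,
      u x = [ffun p : I => if tag p == j' then
        (c (tagged p))%:A *: s j' x else 0].
    apply: linear_ex => b x y; apply/ffunP => p; rewrite !ffunE.
    case: eqP => _; last by rewrite scaler0 addr0.
    rewrite linearP scalerDr !scalerA; congr (_ *: _ + _).
    by rewrite -scalerAl -scalerAr mul1r mulr1.
  exists u => x; rewrite FE.
  transitivity (\sum_(j1 : J) \sum_(l < d j1)
      (e j1 l : Hom _ _) (t j1 (u x (Tagged _ l)))).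
    by rewrite sig_big_dep; apply: eq_big => -[].
  rewrite (bigD1 j') //= [X in _ + X]big1 => [|j1 j1j]; last first.
    rewrite big1 // => l _; rewrite uE ffunE /= (negPf j1j).
    by rewrite !linear0.
  rewrite addr0 cE homk_sumE; apply: eq_bigr => l _.
  by rewrite uE ffunE /= eqxx !linearZ /= st.
have def0 : def i0 = 0.
  have ad_ge0 j : 0 <= a j * def j.
    have [aj|aj] := ltP (a j) 0; first by rewrite def_neg // mulr0.
    exact: mulr_ge0.
  have /eqP : a i0 * def i0 = 0.
    apply/eqP; rewrite eq_le ad_ge0 andbT -sum0 (bigD1 i0) //= lerDl.
    exact: sumr_ge0.
  by rewrite mulf_eq0 gt_eqF //= => /eqP.
have [_ _] := rP i0; case=> + _.
move/eqP: def0; rewrite subr_eq0 => /eqP/eqP; rewrite eqr_nat => /eqP ->.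
move=> /(_ (leqnn _) idfun)[u Fu].
have [q qE] := choice (@ffun_proj_ex _ I M).
(* The lift u writes the identity of X_i0 as a sum of maps through those X_j with a_j < 0. By
   Krull-Schmidt X_i0 is one of them, against a_i0 > 0. *)
have [|p Xp] := @indec_retract_sum_fin (X i0) I (fun p => X (val (tag p)))
  (fun p => t (tag p) \o (q p \o u)) (fun p => (e (tag p) (tagged p) : Hom _ _))
  (Xd i0) (XM i0).1.
  by move=> x; rewrite -[RHS]Fu FE; apply: eq_bigr => p _ /=; rewrite qE.
have := Xinj _ _ (indec_retract_iso (XM i0).1.1 (XM _).1 Xp).
move=> e0; have := valP (tag p); rewrite -e0; case: ltgtP ai0 => //.
Qed.

Hypothesis Cd : fdim (C : lmodType k).

(** The c_j count the indecomposable projectives in a decomposition of P. *)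
Lemma hd_proj n (Y : 'I_n -> lmodType C) :
  (forall X, indecomposable X -> summand X C^o -> exists i, iso X (Y i)) ->
  forall P, proj P -> exists c : 'I_n -> nat,
    forall Z, fdm Z -> hd P Z = (\sum_j c j * hd (Y j) Z)%N.
Proof.
move=> CY P Pp; have Pd := fingen_fdm Cd Pp.1; move: P Pd Pp.
apply: fdm_ind => [X X' XX' IH X'p|X X0 _|X Xi Xp|X X' IH IH' XX'p].
- have [c cE] := IH (retract_proj (iso_retract XX') X'p).
  by exists c => Z Zd; rewrite -(hd_iso _ XX') cE.
- exists (fun=> 0%N) => Z Zd; rewrite big1 // hd_eq0 // => -[f [x fx]].
  by apply: X0; exists x; apply: contraNneq fx => ->; rewrite linear0.
- have Xd := fingen_fdm Cd Xp.1.
  have [|j Xj] := CY X Xi.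
    have /fingenP[l [g gs]] := Xp.1; have [i gi] := Xp.2 _ _ g idfun gs.
    by apply/summandP/(indec_retract_ffun Xd Xi (n := l)); exists i, g.
  exists (fun i => (i == j) : nat) => Z Zd; rewrite (hd_iso _ Xj).
  rewrite (bigD1 j) //= eqxx mul1n big1 ?addn0 // => i /negPf ->.
  by rewrite mul0n.
have Xp := retract_proj (retract_prodl X X') XX'p.
have X'p := retract_proj (retract_prodr X X') XX'p.
have [c cE] := IH Xp; have [c' c'E] := IH' X'p.
exists (fun j => c j + c' j)%N => Z Zd; rewrite hd_prod ?cE ?c'E //.
- by rewrite -big_split; apply: eq_bigr => j _; rewrite mulnDl.
- exact: Xp.1.
exact: X'p.1.
Qed.

(* The g-vector of X; on Fac M the term Hom(Z, tau X) of the usual formula vanishes. *)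
Lemma g_vector n (Y : 'I_n -> lmodType C) M X :
  (forall X, indecomposable X -> summand X C^o -> exists i, iso X (Y i)) ->
  fdm X -> relproj X M -> exists g : 'I_n -> rat,
    forall Z, fdm Z -> Fac M Z -> (hd X Z)%:R = \sum_j g j * (hd (Y j) Z)%:R.
Proof.
move=> CY Xd XM; have [P1 [P0 [f [g mp]]]] := min_pres_exists Cd Xd.
have [[P1p P0p] gs gf _ _] := mp.
have [c1 c1E] := hd_proj CY P1p; have [c0 c0E] := hd_proj CY P0p.
exists (fun j => (c0 j)%:R - (c1 j)%:R) => Z Zd MZ.
have fZ := relproj_hom_surj mp (relproj_Fac MZ XM).
have [F FE] := @precomp_ex _ _ _ _ Z f; have [G GE] := @precomp_ex _ _ _ _ Z g.
have : hd P0 Z = (hd X Z + hd P1 Z)%N.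
  have [|||||_ //] := @dim_exact _ _ _ _ G F.
  - move=> u v e; apply: HomP => x; have [y <-] := gs x.
    by rewrite -!GE e.
  - by move=> u; have [v vE] := fZ u; exists v; apply: HomP => x; rewrite FE vE.
  - move=> u; split=> [Fu|[v <-]]; last first.
      apply: HomP => x; rewrite FE GE; have -> : g (f x) = 0 by apply/gf; exists x.
      exact: linear0.
    have [|v vE] := factor_surj (f := (u : Hom _ _)) gs.
      by move=> y /gf[x <-]; rewrite -FE Fu.
    by exists v; apply: HomP => x; rewrite GE vE.
  - exact: fdim_hom (fdm_fingen Xd) Zd.
  exact: fdim_hom P1p.1 Zd.
move=> e; under eq_bigr => j _ do rewrite mulrBl -!natrM.
by rewrite sumrB -!natr_sum -c0E // -c1E // e natrD addrK.
Qed.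

(** The rows of the matrix [A] are the g-vectors of the X_i and the unit vectors of the Y_j
    occurring in P. With more than n rows, a linear relation makes a combination of the dim Hom(X_i,
    -) vanish on Fac M: columns outside P cancel, and for Y_j in P the function dim Hom(Y_j, -) is
    zero there. *)
Lemma rigid_bound M P m p n : fdm M -> relproj M M -> proj P ->
  ~ hom_nonzero P M -> card_ind M m -> card_ind P p -> card_ind C^o n ->
  (m + p <= n)%N.
Proof.
move=> Md Mr Pp PM [X [XM Xinj _]] [Q [QP Qinj _]] [Y [YC Yinj CY]].
rewrite leqNgt; apply/negP => nmp.
have XM' i : indecomposable (X i) /\ retract (X i) M.
  by have [Xi /summandP] := XM i.
have [G GE] := choice (fun i => g_vector CY (fdm_retract (XM' i).2 Md)
  (retract_relproj (XM' i).2 Mr)).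
have QP' i : indecomposable (Q i) /\ retract (Q i) P.
  by have [Qi /summandP] := QP i.
have [|s [sinj sE]] := @match_exists _ _ _ _ Q Y Qinj.
  move=> l; have Qp := retract_proj (QP' l).2 Pp.
  have Qd := fingen_fdm Cd Qp.1.
  apply: CY (QP' l).1 _; apply/summandP.
  have /fingenP[r [g gs]] := Qp.1; have [i gi] := Qp.2 _ _ g idfun gs.
  by apply: (indec_retract_ffun Qd (QP' l).1 (n := r)); exists i, g.
have Y0 l Z : Fac M Z -> hd (Y (s l)) Z = 0%N.
  move=> MZ; rewrite -(hd_iso _ (sE l)) hd_eq0 // => QZ.
  have Qp := retract_proj (QP' l).2 Pp.
  have [f [x fx]] := hom_nonzero_Fac Qp.2 MZ QZ.
  have [_ [i [q iq]]] := QP' l.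
  by apply: PM; exists (f \o q), (i x); rewrite /= iq.
pose A : 'M[rat]_(m + p, n) :=
  col_mx (\matrix_(i, j) G i j) (\matrix_(l, j) (j == s l)%:R).
have [w [wA w0]] : exists w : 'rV[rat]_(m + p), w *m A = 0 /\ w != 0.
  apply: contrapT => /forallNP wA; move: nmp; apply/negP; rewrite -leqNgt.
  have [f fE] : exists f : {linear 'rV[rat]_(m + p) -> 'rV[rat]_n},
      forall w, f w = w *m A.
    by apply: linear_ex => a x y; rewrite mulmxDl scalemxAl.
  apply: (@rV_inj_leq _ _ _ f); apply/inj_linearP => w; rewrite fE => wA0.
  by apply/eqP; apply: contrapT => /negP w0; apply: (wA w).
pose a i := lsubmx w 0 i.
have aG j : (forall l, j != s l) -> \sum_i a i * G i j = 0.
  move=> js; move/matrixP/(_ 0 j): wA; rewrite -[w]hsubmxK mul_row_col !mxE.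
  rewrite [X in _ + X]big1 ?addr0 => [wA|l _]; last by rewrite !mxE (negPf (js l)) mulr0.
  by rewrite -[RHS]wA; apply: eq_bigr => i _; rewrite /a !mxE.
(* The unit rows are independent, so the relation involves some X_i. *)
have a0 : exists i, a i != 0.
  apply: contrapT => /forallNP a0; case/negP: w0; apply/eqP.
  have l0 : lsubmx w = 0.
    by apply/rowP => i; have /negP := a0 i; rewrite negbK [RHS]mxE => /eqP.
  suff r0 : rsubmx w = 0 by rewrite -[w]hsubmxK l0 r0 row_mx0.
  have : rsubmx w *m (\matrix_(l, j) (j == s l)%:R) = 0 :> 'rV_n.
    by move: wA; rewrite -[w]hsubmxK mul_row_col l0 mul0mx add0r row_mxKr.
  move: (rsubmx w) => r /matrixP rs; apply/rowP => l; have := rs 0 (s l).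
  rewrite [LHS]mxE [RHS]mxE (bigD1 l) //= big1 => [|l' l'l].
    by rewrite !mxE eqxx mulr1 addr0.
  by rewrite !mxE (inj_eq sinj) eq_sym (negPf l'l) mulr0.
have aZ Z : fdm Z -> Fac M Z -> \sum_i a i * (hd (X i) Z)%:R = 0.
  move=> Zd MZ; transitivity (\sum_j (\sum_i a i * G i j) * (hd (Y j) Z)%:R).
    under eq_bigr => i _ do rewrite GE // mulr_sumr.
    rewrite exchange_big; apply: eq_bigr => j _; rewrite mulr_suml.
    by apply: eq_bigr => i _; rewrite mulrA.
  rewrite big1 // => j _; have [[l ->]|/forallNP js] := pselect (exists l, j = s l).
    by rewrite Y0 // mulr0.
  by rewrite aG ?mul0r // => l; apply/eqP.
(* Independence in its one-sided form is applied to a and to -a. *)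
have [i /negP] := a0; apply; rewrite eq_le (hom_independent Md XM' Xinj aZ) /=.
rewrite -oppr_le0; apply: (hom_independent (a := fun i => - a i) Md XM' Xinj) => Z Zd MZ.
by under eq_bigr => j _ do rewrite mulNr; rewrite sumrN aZ // oppr0.
Qed.
End Rank.

(** * The one-point extension *)

Section OnePointExtension.
Context (k : fieldType) (B : algType k) (P0 : lmodType B).
Notation A := (onept P0).
Notation oB b := (Onept b 0 0 : A).
Notation oP p := (Onept 0 p 0 : A).
Notation oU u := (Onept u.1 u.2 0 : A).
Notation e0 := (Onept 0 0 1 : A).

Fact o_c_zmod : zmod_morphism (@o_c _ _ P0). Proof. by []. Qed.
Fact o_c_monoid : monoid_morphism (@o_c _ _ P0). Proof. by []. Qed.
HB.instance Definition _ := GRing.isZmodMorphism.Build A k (@o_c _ _ P0) o_c_zmod.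
HB.instance Definition _ := GRing.isMonoidMorphism.Build A k (@o_c _ _ P0) o_c_monoid.

(** The model of S: A acts on k through its lower right entry. [new_projective_top] identifies the
    given S with it. *)
Definition simple0 : lmodType A := restr (@o_c _ _ P0) k^o.

Definition one0 : simple0 := (1 : k).

Lemma simple0_scale (a : A) (t : simple0) : a *: t = o_c a * (t : k) :> k.
Proof. by []. Qed.

Lemma oBU b (u : rowU P0) : oB b * oU u = oU (b *: u).
Proof. by rewrite rowU_scaleE. Qed.

Lemma oUa (u : rowU P0) (a : A) : oU u * a = oU (rowU_act u a).
Proof. by rewrite rowU_actE. Qed.

Lemma o_split (a : A) : a = oU (o_b a, o_p a) + (o_c a) *: e0.
Proof.
apply: o_eq.
- by rewrite -[RHS]/(o_b a + o_c a *: 0) scaler0 addr0.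
- by rewrite -[RHS]/(o_p a + (o_c a)%:A *: 0) scaler0 addr0.
by rewrite -[RHS]/(0 + o_c a * 1) mulr1 add0r.
Qed.

Lemma e0_mul (a : A) : e0 * a = o_c a *: e0.
Proof.
apply: o_eq.
- by rewrite -[LHS]/(0 * o_b a) mul0r -[RHS]/(o_c a *: 0) scaler0.
- by rewrite o_pM o_pZ scale0r !scaler0 addr0.
by rewrite -[LHS]/(1 * o_c a) -[RHS]/(o_c a * 1) mul1r mulr1.
Qed.

Lemma mul_oB (a : A) : a * oB 1 = oB (o_b a).
Proof.
apply: o_eq.
- by rewrite -[LHS]/(o_b a * 1) mulr1.
- by rewrite o_pM scaler0 /o_c /= scale0r scale0r addr0.
by rewrite -[LHS]/(o_c a * 0) mulr0.
Qed.

Lemma one_split : 1 = oB 1 + e0 :> A.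
Proof.
by apply: o_eq; rewrite -?[RHS]/(1 + 0) -?[RHS]/(0 + 0) -?[RHS]/(0 + 1) ?addr0 ?add0r.
Qed.

(** * The B-module e_B X of an A-module X *)

Section Corner.
Context (X : lmodType A).

(** As [oB 1] is the idempotent e_B, its fixed vectors form e_B X. *)
Definition cpred : {pred X} := [pred x | oB 1 *: x == x].

Fact cpred_zmod : zmod_closed cpred.
Proof.
split=> [|x y]; rewrite !inE ?scaler0 // => /eqP xE /eqP yE.
by rewrite scalerBr xE yE.
Qed.
HB.instance Definition _ := GRing.isZmodClosed.Build X cpred cpred_zmod.

Record corner := Corner { corner_val :> X; _ : corner_val \in cpred }.
HB.instance Definition _ := [isSub for corner_val].
HB.instance Definition _ := [Choice of corner by <:].
HB.instance Definition _ := [SubChoice_isSubZmodule of corner by <:].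

Lemma oU_cpred (u : rowU P0) x : oU u *: x \in cpred.
Proof. by rewrite inE scalerA oBU scale1r. Qed.

Definition corner_act (u : rowU P0) x : corner := Corner (oU_cpred u x).

Definition corner_scale (b : B) (x : corner) : corner :=
  corner_act ((b, 0) : rowU P0) (val x).

Lemma corner_actE u x : val (corner_act u x) = oU u *: x. Proof. by []. Qed.
Lemma corner_id (x : corner) : oB 1 *: val x = val x.
Proof. by case: x => x /= /eqP. Qed.

Fact corner_scaleA a b x : corner_scale a (corner_scale b x) = corner_scale (a * b) x.
Proof.
apply: val_inj; rewrite !corner_actE scalerA (oBU a) /=.
by congr (Onept _ _ _ *: _); rewrite scaler0.
Qed.
Fact corner_scale1 : left_id 1 corner_scale.
Proof. by move=> x; apply: val_inj; rewrite corner_actE corner_id. Qed.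
Fact corner_scaleDr : right_distributive corner_scale +%R.
Proof. by move=> a x y; apply: val_inj; rewrite /= scalerDr. Qed.
Fact corner_scaleDl x : {morph corner_scale^~ x : a b / a + b}.
Proof.
move=> a b; apply: val_inj; rewrite /= -scalerDl; congr (_ *: _).
by apply: o_eq; rewrite // -?[RHS]/(0 + 0) addr0.
Qed.
HB.instance Definition _ := GRing.Zmodule_isLmodule.Build B corner
  corner_scaleA corner_scale1 corner_scaleDr corner_scaleDl.
End Corner.

Lemma infl_scale (M : lmodType B) (a : A) (x : infl P0 M) :
  a *: x = o_b a *: (x : M).
Proof. by []. Qed.

Lemma infl_map (M N : lmodType B) (g : {linear M -> N}) :
  exists h : {linear infl P0 M -> infl P0 N}, forall x, h x = g x.
Proof.
apply: (@linear_ex A (infl P0 M) (infl P0 N)) => a x y; rewrite !infl_scale.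
exact: linearP.
Qed.

Lemma infl_full (M N : lmodType B) (h : {linear infl P0 M -> infl P0 N}) :
  exists g : {linear M -> N}, forall x, g x = h x.
Proof.
apply: (@linear_ex B M N) => b x y.
by rewrite -[b *: x]/((oB b) *: (x : infl P0 M)) linearP.
Qed.

Lemma proj_infl (Q : lmodType B) : proj (infl P0 Q) -> proj Q.
Proof.
move=> [[s sP] Qp]; split.
  exists s => x; have [c cE] := sP x; exists (fun i => o_b (c i)).
  exact: cE.
move=> X Y g f gs; have [g' g'E] := infl_map g; have [f' f'E] := infl_map f.
have [|h hE] := Qp _ _ g' f'.
  by move=> y; have [x <-] := gs y; exists x; rewrite g'E.
by have [h' h'E] := infl_full h; exists h' => x; rewrite h'E -g'E hE f'E.
Qed.

Lemma infl_corner (X : lmodType A) : (forall x : X, e0 *: x = 0) ->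
  iso X (infl P0 (corner X)).
Proof.
move=> X0; have X1 (x : X) : oB 1 *: x = x.
  by rewrite -[RHS]scale1r one_split scalerDl X0 addr0.
have [f fE] : exists f : {linear X -> infl P0 (corner X)},
    forall x, f x = corner_act ((1, 0) : rowU P0) x.
  apply: linear_ex => a x y; apply: val_inj.
  rewrite infl_scale [RHS]raddfD /= !X1 -mul_oB -scalerA X1.
  by [].
apply: (@bij_linear_iso _ _ _ f).
  by move=> x y; rewrite !fE => /(congr1 val); rewrite !corner_actE /= !X1.
move=> y; exists (val (y : corner X)); rewrite fE.
by apply: val_inj; rewrite corner_actE X1.
Qed.

(** * The functor E on maps *)

Implicit Types (M N K L : lmodType B).

Definition uhom M (f : calE P0 M) : Hom (rowU P0) M := f.

Lemma calE_ext M (f g : calE P0 M) : (forall u, uhom f u = uhom g u) -> f = g.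
Proof. exact: HomP. Qed.

Lemma uhom_scale M (a : A) (f : calE P0 M) u : uhom (a *: f) u = uhom f (rowU_act u a).
Proof. by []. Qed.

Lemma uhomD M (f g : calE P0 M) u : uhom (f + g) u = uhom f u + uhom g u.
Proof. by []. Qed.

Definition one_u : rowU P0 := (1, 0).

Lemma act_one u : rowU_act one_u (oU u) = u.
Proof.
case: u => b p; rewrite /rowU_act /o_b /o_p /o_c /= mul1r scale1r.
by rewrite scaler0 addr0.
Qed.

(** These maps form the copy of M inside E M: by [oU_hat], e_B f is the hat of the value of f at
    e_B, so they make up e_B (E M). *)
Lemma hat_ex M (x : M) : exists f : calE P0 M, forall u, uhom f u = u.1 *: x.
Proof.
have [f fE] : exists f : {linear rowU P0 -> M}, forall u, f u = u.1 *: x.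
  by apply: linear_ex => a u v; rewrite /= scalerDl scalerA.
by exists f.
Qed.

Definition hat M (x : M) : calE P0 M := projT1 (cid (hat_ex x)).

Lemma hatE M (x : M) u : uhom (hat x) u = u.1 *: x.
Proof. by rewrite /hat; case: cid. Qed.

Lemma oU_hat M (f : calE P0 M) u : oU u *: f = hat (uhom f u).
Proof.
apply: calE_ext => -[b p]; rewrite uhom_scale hatE /= -linearZ; congr (uhom f _).
by rewrite /rowU_act /o_b /o_p /o_c /= scale0r scale0r addr0.
Qed.

Lemma calE_map M N (g : {linear M -> N}) :
  exists h : {linear calE P0 M -> calE P0 N}, forall f u, uhom (h f) u = g (uhom f u).
Proof.
have [h hE] : exists h : {linear calE P0 M -> calE P0 N},
    forall f, h f = (g \o uhom f : {linear _ -> _}).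
  by apply: linear_ex => a x y; apply: calE_ext => u; rewrite /= linearD.
by exists h => f u; rewrite hE.
Qed.

(** An A-linear h commutes with the action of U, and u f is the hat of f(u). So the value of h f at
    u is that of h (hat (f u)) at e_B, which dictates g. *)
Lemma calE_full M N (h : {linear calE P0 M -> calE P0 N}) :
  exists g : {linear M -> N}, forall f u, uhom (h f) u = g (uhom f u).
Proof.
have key (f : calE P0 M) u : uhom (h f) u = uhom (h (hat (uhom f u))) one_u.
  by rewrite -oU_hat (linearZZ h) oU_hat hatE scale1r.
have [g gE] : exists g : {linear M -> N}, forall x, g x = uhom (h (hat x)) one_u.
  apply: linear_ex => b x y.
  have -> : hat (b *: x + y) = oB b *: hat x + hat y.
    apply: calE_ext => u; rewrite uhomD uhom_scale !hatE /= scalerDr scalerA.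
    by rewrite /o_b.
  rewrite linearP uhomD uhom_scale; congr (_ + _).
  rewrite -linearZ; congr (uhom _ _).
  by rewrite (act_one ((b, 0) : rowU P0)) -[RHS]/((b * 1, b *: 0) : rowU P0) mulr1 scaler0.
by exists g => f u; rewrite gE key.
Qed.

(** * Fully faithful functors from mod B to mod A *)

Section FullyFaithful.
(** The action on maps is a relation G, since the maps themselves come from existence statements;
    [infl] and [calE] are the two instances. *)
Context (F : lmodType B -> lmodType A)
  (G : forall M N, {linear M -> N} -> {linear F M -> F N} -> Prop).
Arguments G {M N}.
Hypotheses
  (Gmap : forall M N (g : {linear M -> N}), exists h, G g h)
  (Gfull : forall M N (h : {linear F M -> F N}), exists g, G g h)
  (Gcomp : forall M N K (g : {linear M -> N}) (g' : {linear N -> K}) h h',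
    G g h -> G g' h' -> G (g' \o g) (h' \o h))
  (Gid : forall M, G (idfun : {linear M -> M}) idfun)
  (Geq : forall M N (g g' : {linear M -> N}) h h', G g h -> G g' h' ->
    (forall x, g x = g' x) <-> (forall x, h x = h' x))
  (G0 : forall M N (g : {linear M -> N}) h, G g h ->
    (forall x, g x = 0) <-> (forall x, h x = 0)).

Lemma ff_nonzero M : nonzero M <-> nonzero (F M).
Proof.
have GM := G0 (Gid M).
by split=> h; apply: contrapT => /nonzeroPn/GM n0; apply: (nonzeroPn _).2 h.
Qed.

Lemma ff_retract M N : retract M N <-> retract (F M) (F N).
Proof.
split=> -[i [p ip]].
  have [i' ii'] := Gmap i; have [p' pp'] := Gmap p.
  exists i', p'; apply/(Geq (Gcomp ii' pp') (Gid M)); exact: ip.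
have [i' ii'] := Gfull i; have [p' pp'] := Gfull p.
exists i', p'; apply/(Geq (Gcomp ii' pp') (Gid M)); exact: ip.
Qed.

Lemma ff_iso M N : iso M N <-> iso (F M) (F N).
Proof.
rewrite !isoP; split=> -[f [g [fg gf]]].
  have [f' ff'] := Gmap f; have [g' gg'] := Gmap g.
  exists f', g'; split.
    by apply/(Geq (Gcomp ff' gg') (Gid M)); exact: fg.
  by apply/(Geq (Gcomp gg' ff') (Gid N)); exact: gf.
have [f' ff'] := Gfull f; have [g' gg'] := Gfull g.
exists f', g'; split.
  by apply/(Geq (Gcomp ff' gg') (Gid M)); exact: fg.
by apply/(Geq (Gcomp gg' ff') (Gid N)); exact: gf.
Qed.

Lemma ff_indec M : indecomposable M <-> indecomposable (F M).
Proof.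
rewrite !indecP ff_nonzero; split=> -[M0 MP]; split=> // e ee.
  have [g ge] := Gfull e; have [|g0|g1] := MP g.
  - by apply/(Geq (Gcomp ge ge) ge).
  - by left; apply/(G0 ge).
  by right; apply/(Geq ge (Gid M)).
have [h eh] := Gmap e; have [|h0|h1] := MP h.
- by apply/(Geq (Gcomp eh eh) eh).
- by left; apply/(G0 eh).
by right; apply/(Geq eh (Gid M)).
Qed.

(** The idempotent of F N that cuts out X comes from one of N, which splits there. Thus every
    summand of F N is seen over B. *)
Lemma ff_image N (X : lmodType A) : retract X (F N) ->
  exists Y, retract Y N /\ iso X (F Y).
Proof.
move=> [i [p ip]]; have [e Ge] := Gfull (i \o p).
have ee : forall x, e (e x) = e x.
  by apply/(Geq (Gcomp Ge Ge) Ge) => x /=; rewrite ip.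
have [Y [j [q [ji qs jq]]]] := im_exists e.
have qj : cancel j q.
  by move=> y; apply: ji; have [x <-] := qs y; rewrite !jq ee.
exists Y; split; first by exists j, q.
have [j' jj'] := Gmap j; have [q' qq'] := Gmap q.
have q'j' : forall x, q' (j' x) = x.
  by apply/(Geq (Gcomp jj' qq') (Gid Y)).
have j'q' : forall x, j' (q' x) = i (p x).
  by apply/(Geq (Gcomp qq' jj') Ge).
apply/isoP; exists (q' \o i), (p \o j'); split=> x /=.
  by rewrite j'q' !ip.
by rewrite -j'q' !q'j'.
Qed.

Lemma ff_card N n : card_ind (F N) n -> card_ind N n.
Proof.
move=> [X [XM Xi MX]].
have Yex i : exists Y, retract Y N /\ iso (X i) (F Y).
  by apply: ff_image; apply/summandP; have [] := XM i.
have [Y YP] := choice Yex; exists Y; split.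
- move=> i; have [YN XY] := YP i; split; last exact/summandP.
  apply/ff_indec; have [[Xi0 XiP] _] := XM i; split.
    have [x x0] := Xi0; have /isoP[f [g [fg gf]]] := XY.
    by exists (f x); apply: contraNneq x0 => e; rewrite -[x]fg e linear0.
  by move=> U V UV; apply: XiP; exact: iso_trans XY UV.
- move=> i j /ff_iso YY; apply: Xi; apply: iso_trans (YP i).2 _.
  exact: iso_trans YY (iso_sym (YP j).2).
move=> Z Zi /summandP/ff_retract ZN.
have [||i ZX] := MX (F Z); [exact/ff_indec|exact/summandP|].
by exists i; apply/ff_iso; exact: iso_trans ZX (YP i).2.
Qed.

(** Nothing is assumed about F on products, so the retraction onto F X x F X is assembled from the
    four entries of its matrix. *)
Lemma ff_basic N : basic (F N) -> basic N.
Proof.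
move=> Nb X Xi /summandP[i [p ip]]; apply: (Nb (F X)); first exact/ff_indec.
apply/summandP.
have [l lE] := inl_ex X X; have [r rE] := inr_ex X X.
have [f fE] := fst_ex X X; have [s sE] := snd_ex X X.
have [il ilG] := Gmap (i \o l); have [ir irG] := Gmap (i \o r).
have [pf pfG] := Gmap (f \o p); have [ps psG] := Gmap (s \o p).
have [I IE] := copair_ex il ir; have [P PE] := pair_ex pf ps.
exists I, P => -[x y]; rewrite IE PE !linearD /=; congr (_, _).
  have -> : pf (il x) = x.
    move: x; apply/(Geq (Gcomp ilG pfG) (Gid X)) => x /=.
    by rewrite ip lE fE.
  have -> : pf (ir y) = 0; last by rewrite addr0.
  move: y; apply/(G0 (Gcomp irG pfG)) => y /=.
  by rewrite ip rE fE.
have -> : ps (ir y) = y.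
  move: y; apply/(Geq (Gcomp irG psG) (Gid X)) => y /=.
  by rewrite ip rE sE.
have -> : ps (il x) = 0; last by rewrite add0r.
move: x; apply/(G0 (Gcomp ilG psG)) => x /=.
by rewrite ip lE sE.
Qed.
End FullyFaithful.

Definition infl_rel M N (g : {linear M -> N}) (h : {linear infl P0 M -> infl P0 N}) :=
  forall x, h x = g x.

Definition calE_rel M N (g : {linear M -> N}) (h : {linear calE P0 M -> calE P0 N}) :=
  forall f u, uhom (h f) u = g (uhom f u).

Lemma infl_card N n : card_ind (infl P0 N) n -> card_ind N n.
Proof.
apply: (@ff_card _ infl_rel).
- exact: infl_map.
- by move=> M K h; have [g gE] := infl_full h; exists g => x; rewrite gE.
- by move=> M K L g g' h h' gh gh' x; rewrite /= gh' gh.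
- by [].
- by move=> M K g g' h h' gh gh'; split=> e x; have := e x; rewrite gh gh'.
by move=> M K g h gh; split=> e x; have := e x; rewrite gh.
Qed.

Lemma infl_basic N : basic (infl P0 N) -> basic N.
Proof.
apply: (@ff_basic _ infl_rel).
- exact: infl_map.
- by move=> M K h; have [g gE] := infl_full h; exists g => x; rewrite gE.
- by move=> M K L g g' h h' gh gh' x; rewrite /= gh' gh.
- by [].
- by move=> M K g g' h h' gh gh'; split=> e x; have := e x; rewrite gh gh'.
by move=> M K g h gh; split=> e x; have := e x; rewrite gh.
Qed.

Lemma calE_relE M N (g : {linear M -> N}) h : calE_rel g h ->
  forall x, g x = uhom (h (hat x)) one_u.
Proof. by move=> gh x; rewrite gh hatE scale1r. Qed.

Lemma calE_rel_comp M N K (g : {linear M -> N}) (g' : {linear N -> K}) h h' :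
  calE_rel g h -> calE_rel g' h' -> calE_rel (g' \o g) (h' \o h).
Proof. by move=> gh gh' f u; rewrite /= gh' gh. Qed.

Lemma calE_rel_eq M N (g g' : {linear M -> N}) h h' :
  calE_rel g h -> calE_rel g' h' ->
  (forall x, g x = g' x) <-> (forall x, h x = h' x).
Proof.
move=> gh gh'; split=> e x; last by rewrite (calE_relE gh) (calE_relE gh') e.
by apply: calE_ext => u; rewrite gh gh'.
Qed.

Lemma calE_rel0 M N (g : {linear M -> N}) h :
  calE_rel g h -> (forall x, g x = 0) <-> (forall x, h x = 0).
Proof.
move=> gh; split=> e x; last by rewrite (calE_relE gh) e.
by apply: calE_ext => u; rewrite gh e.
Qed.

Lemma calE_card N n : card_ind (calE P0 N) n -> card_ind N n.
Proof.
by apply: (ff_card (@calE_map) (@calE_full) (@calE_rel_comp) _ (@calE_rel_eq) (@calE_rel0)).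
Qed.

Lemma calE_basic N : basic (calE P0 N) -> basic N.
Proof.
by apply: (ff_basic (@calE_map) (@calE_full) (@calE_rel_comp) _ (@calE_rel_eq) (@calE_rel0)).
Qed.

Hypothesis P0p : proj P0.

(* [calE] is exact because [rowU] is projective over B, and fully faithful; so it
   carries a lifting problem over B to one over A and back. *)
Lemma relproj_calE N : relproj (calE P0 N) (calE P0 N) -> relproj N N.
Proof.
have Up : proj (rowU P0) by apply: proj_prod; first exact: proj_regular.
move=> ENp E F I q g gs gq f.
have [g' g'E] := calE_map g; have [f' f'E] := calE_map f.
have [q' q'E] : exists q' : {linear {ffun I -> calE P0 N} -> calE P0 E},
    forall z u, uhom (q' z) u = q [ffun i => uhom (z i) u].
  have zex (z : {ffun I -> calE P0 N}) : exists w : calE P0 E,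
      forall u, uhom w u = q [ffun i => uhom (z i) u].
    have [t tE] := ffun_map_ex (fun i => uhom (z i)).
    by exists (q \o t : {linear _ -> _}) => u; rewrite /= tE.
  have [s sE] := choice zex.
  have [q' q'E] : exists q' : {linear {ffun I -> calE P0 N} -> calE P0 E},
      forall z, q' z = s z.
    apply: linear_ex => a x y; apply: calE_ext => u.
    rewrite uhomD uhom_scale !sE -linearD; congr (q _).
    by apply/ffunP => i; rewrite !ffunE.
  by exists q' => z u; rewrite q'E sE.
have [||h hE] := ENp _ _ I q' g' _ _ f'.
- move=> y; have [x xE] := Up.2 _ _ g (uhom y) gs.
  by exists x; apply: calE_ext => u; rewrite g'E; exact: xE.
- move=> y; split=> [gy|[x <-]]; last first.
    apply: calE_ext => u; rewrite g'E q'E; apply/gq.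
    by exists [ffun i => uhom (x i) u].
  have [|w wE] := @proj_lift _ _ _ _ q (uhom y) Up.
    by move=> u; apply/gq; rewrite -g'E gy.
  have [p pE] := choice (@ffun_proj_ex _ I N).
  exists [ffun i => (p i \o w : {linear _ -> _}) : calE P0 N].
  apply: calE_ext => u; rewrite q'E -[RHS]wE; congr (q _).
  by apply/ffunP => i; rewrite !ffunE /uhom /= pE.
have [h' h'E] := calE_full h; exists h' => x.
have := congr1 (fun w => uhom w one_u) (hE (hat x)).
by rewrite g'E h'E f'E hatE scale1r.
Qed.

(** The map [hat] embeds N, inflated to A, into E N and is A-linear; compose with it. *)
Lemma hom_infl_calE M N : hom_nonzero M N -> hom_nonzero (infl P0 M) (calE P0 N).
Proof.
move=> [f [x fx]].
have [h hE] : exists h : {linear infl P0 M -> calE P0 N}, forall y, h y = hat (f y).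
  apply: linear_ex => a y z; apply: calE_ext => u.
  rewrite uhomD uhom_scale !hatE infl_scale linearD linearZ scalerDr /= scalerA.
  by [].
exists h, x; rewrite hE; apply: contraNneq fx => /(congr1 (fun w => uhom w one_u)).
by rewrite hatE scale1r => ->.
Qed.

(** * The simple module S and the unit X -> E (e_B X) *)

Hypothesis Bd : fdim (B : lmodType k).

Lemma onept_fdim : fdim (A : lmodType k).
Proof.
have [m Bm] := Bd; have [n Pn] := fingen_fdm Bd P0p.1.
have k1 : dim_is (k^o : lmodType k) 1.
  have [f fE] : exists f : {linear k^o -> 'rV[k]_1}, forall x, f x = const_mx x.
    by apply: linear_ex => a x y; apply/rowP => i; rewrite !mxE.
  exists f; exists (fun u : 'rV[k]_1 => u 0 0) => [x|u]; rewrite fE ?mxE //.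
  by apply/rowP => i; rewrite mxE !ord1.
exists (m + n + 1)%N.
exact: (dim_prod (dim_prod Bm Pn) k1).
Qed.

Lemma simple0_fdm : fdm simple0.
Proof.
have [p pE] : exists p : {linear A^o -> simple0}, forall a, p a = o_c a.
  exact: linear_ex.
have ps : surj p by move=> t; exists (Onept 0 0 t : A); rewrite pE.
by have [] := fdm_surj ps (fdm_regular onept_fdim).
Qed.

Lemma simple0_indec : indecomposable simple0.
Proof.
apply/indecP; split; first by exists one0; exact: (oner_neq0 k).
move=> e ee.
have eE (t : simple0) : e t = (t : k) * (e one0 : k) :> k.
  transitivity (e ((Onept 0 0 (t : k) : A) *: one0 : simple0)).
    by congr (e _); rewrite -[RHS]/((t : k) * 1) mulr1.
  by rewrite linearZ.
have := ee one0; rewrite eE => /eqP.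
rewrite -subr_eq0 -[X in _ - X]mulr1 -mulrBr mulf_eq0 subr_eq0 => /orP[] /eqP e1.
  by left=> t; rewrite eE e1 mulr0.
by right=> t; rewrite eE e1 mulr1.
Qed.

(** Because e0 A is the line spanned by e0, S is D(e0 A) and Hom(X, S) is the dual of e0 X. This is
    how the injectivity of S is used. *)
Lemma simple0_functional (X : lmodType A) (x : X) : fdm X -> e0 *: x != 0 ->
  exists f : {linear X -> simple0}, f x = one0.
Proof.
move=> Xd x0; have [l lx] := functional (V := kmod X) Xd x0.
have [f fE] : exists f : {linear X -> simple0}, forall y, f y = l (e0 *: y).
  apply: linear_ex => a y z.
  rewrite simple0_scale -[RHS]/(o_c a *: l (e0 *: y) + l (e0 *: z)) -linearP.
  congr (l _); rewrite scalerDr scalerA e0_mul kmod_scale scalerA.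
  by rewrite -scalerAl mul1r.
by exists f; rewrite fE.
Qed.

(** An element killed by U spans a copy of S, and a map X -> S with value 1 at it splits this copy
    off. *)
Lemma simple0_retract (X : lmodType A) (x : X) : fdm X -> x != 0 ->
  (forall u, oU u *: x = 0) -> retract simple0 X.
Proof.
move=> Xd x0 Ux.
have xE : e0 *: x = x.
  rewrite -[RHS]scale1r one_split scalerDl.
  by have := Ux one_u => /= ->; rewrite add0r.
have ax (a : A) : a *: x = (o_c a)%:A *: x.
  rewrite {1}(o_split a) scalerDl (Ux (o_b a, o_p a)) add0r.
  by rewrite -[e0]mul1r scalerAl -scalerA xE.
have [|p px] := @simple0_functional X x Xd; first by rewrite xE.
have [i iE] : exists i : {linear simple0 -> X}, forall t, i t = (t : k)%:A *: x.
  apply: (@linear_ex A simple0 X) => a s t.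
  rewrite scalerA (ax (a * _)) -scalerDl -scalerDl; congr ((_ + _)%:A *: x).
  by rewrite -[RHS]/(o_c a * ((s : k) * 1)) mulr1.
exists i, p => t; rewrite iE linearZ px.
by rewrite -[LHS]/((t : k) * 1 * 1) !mulr1.
Qed.

Local Arguments corner_act : simpl never.
Local Arguments corner_scale : simpl never.

Lemma val_corner_scale (X : lmodType A) (a : A) (z : corner X) :
  val (o_b a *: z) = a *: val z.
Proof. by rewrite -[in RHS]corner_id scalerA mul_oB. Qed.

Lemma val_cornerD (X : lmodType A) (x y : corner X) : val (x + y) = val x + val y.
Proof. by []. Qed.

(* The extension of [simple0] by X along [phi]: since the radical of A e_0 is P0,
   the maps P0 -> X classify these extensions. *)
Definition twist (X : lmodType A) (phi : {linear P0 -> corner X}) : Type :=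
  (X * k^o)%type.

Section Twist.
Context (X : lmodType A) (phi : {linear P0 -> corner X}).
Local Notation twist := (twist phi).

HB.instance Definition _ := GRing.Zmodule.on twist.

Definition twist_scale (a : A) (w : twist) : twist :=
  (a *: w.1 + (w.2 : k)%:A *: val (phi (o_p a)), o_c a * w.2).

Fact twist_scaleA a b w : twist_scale a (twist_scale b w) = twist_scale (a * b) w.
Proof.
congr (_, _); last by rewrite /= mulrA.
have phiM : phi (o_p (a * b)) =
    o_b a *: phi (o_p b) + o_b ((o_c b)%:A : A) *: phi (o_p a).
  by rewrite o_pM linearD !linearZ.
rewrite phiM val_cornerD !val_corner_scale /=.
rewrite scalerDr scalerDr !scalerA -addrA; congr (_ + (_ *: _ + _ *: _)).
  by rewrite alg_comm.
by rewrite -scalerAl mul1r scalerA mulrC.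
Qed.
Fact twist_scale1 : left_id 1 twist_scale.
Proof.
move=> [x t]; congr (_, _); rewrite /= ?mul1r //.
by rewrite scale1r (linear0 phi : phi (o_p 1) = 0) scaler0 addr0.
Qed.
Fact twist_scaleDr : right_distributive twist_scale +%R.
Proof.
move=> a [x t] [y s]; apply: injective_projections => /=; last by rewrite mulrDr.
by rewrite scalerDr !scalerDl addrACA.
Qed.
Fact twist_scaleDl w : {morph twist_scale^~ w : a b / a + b}.
Proof.
move=> a b; apply: injective_projections => /=.
  have -> : phi (o_p (a + b)) = phi (o_p a) + phi (o_p b) by exact: (linearD phi).
  by rewrite scalerDl val_cornerD scalerDr addrACA.
by rewrite -mulrDl.
Qed.
HB.instance Definition _ := GRing.Zmodule_isLmodule.Build A twist
  twist_scaleA twist_scale1 twist_scaleDr twist_scaleDl.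

Lemma twist_scaleE a (w : twist) :
  a *: w = (a *: w.1 + (w.2 : k)%:A *: val (phi (o_p a)), o_c a * w.2).
Proof. by []. Qed.
End Twist.

(** The unit sends x to the map u |-> u x. An element of its kernel is killed by U and would make S
    a summand. For surjectivity, the extension of S by X attached to the restriction of y to P0
    splits, and the splitting corrects the value of y at e_B to a preimage of y. *)
Lemma iso_calE_corner (X : lmodType A) : fdm X -> ~ retract simple0 X ->
  relproj simple0 X -> iso X (calE P0 (corner X)).
Proof.
move=> Xd SX SpX.
have eta_ex (x : X) : exists f : calE P0 (corner X), forall u, val (uhom f u) = oU u *: x.
  have [f fE] : exists f : {linear rowU P0 -> corner X}, forall u, f u = corner_act u x.
    apply: linear_ex => b u v; apply: val_inj.
    rewrite val_cornerD (val_corner_scale (oB b)) !corner_actE scalerA oBU -scalerDl.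
    congr (_ *: _).
    by apply: o_eq; rewrite // -[RHS]/(0 + 0) addr0.
  by exists f => u; rewrite /uhom fE corner_actE.
have [eta etaE] := choice eta_ex.
have [f fE] : exists f : {linear X -> calE P0 (corner X)}, forall x, f x = eta x.
  apply: linear_ex => a x y; apply: calE_ext => u; apply: val_inj.
  by rewrite uhomD uhom_scale val_cornerD !etaE scalerDr scalerA oUa.
apply: (@bij_linear_iso _ _ _ f).
  apply/inj_linearP => x; rewrite fE => ex0; apply/eqP; apply: contrapT => /negP x0.
  apply: SX; apply: (simple0_retract Xd x0) => u.
  by rewrite -etaE ex0.
move=> y; have [r rE] := inr_ex (B^o : lmodType B) P0.
have [phi phiE] : exists phi : {linear P0 -> corner X}, forall p, phi p = uhom y (0, p).
  by exists (uhom y \o r) => p; rewrite /= rE.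
have [g gE] : exists g : {linear twist phi -> simple0}, forall w, g w = w.2.
  exact: linear_ex.
have [q qE] : exists q : {linear {ffun 'I_1 -> X} -> twist phi}, forall x, q x = (x ord0, 0).
  apply: linear_ex => a x z; apply: injective_projections => /=.
    by rewrite !ffunE scale0r scale0r addr0.
  by rewrite mulr0 addr0.
have [||s sE] := SpX _ _ _ q g _ _ idfun.
- by move=> t; exists ((0, t) : twist phi); rewrite gE.
- move=> [x t]; rewrite gE /=; split=> [->|[z]]; last by rewrite qE => -[_ <-].
  by exists [ffun=> x]; rewrite qE ffunE.
have [v vE] : exists v, s one0 = (v, one0) :> twist phi.
  by exists (s one0).1; have := sE one0; rewrite gE /=; case: (s one0) => x t /= ->.
(* U kills S, hence also the lift (v, 1) of its generator; this is the first component of that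
   equation. *)
have vU u : oU u *: v = - val (uhom y (0, u.2)).
  apply/eqP; rewrite -subr_eq0 opprK; apply/eqP.
  have : oU u *: (s one0) = 0.
    by rewrite -linearZ -[X in s X]/((0 * 1 : k) : simple0) mul0r -[X in s X]/0 linear0.
  rewrite vE twist_scaleE /= => -[+ _].
  by rewrite phiE scale1r scale1r.
exists (val (uhom y one_u) - v); rewrite fE; apply: calE_ext => u; apply: val_inj.
rewrite etaE scalerBr vU opprK -val_corner_scale -raddfD -linearZ -linearD.
congr (val (uhom y _)); case: u => b p.
by rewrite -[LHS]/((b * 1 + 0, b *: 0 + p) : rowU P0) mulr1 scaler0 addr0 add0r.
Qed.

(** Were e0 Pt zero, Pt would be a projective B-module; hence some psi : Pt -> S is nonzero. It
    turns out that Pt is generated by e0 v with psi v = 1, and that the kernel of psi is the only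
    maximal submodule of Pt. *)
Lemma new_projective_top (Pt S : lmodType A) :
  new_projective Pt -> is_top Pt S -> iso S simple0.
Proof.
move=> [Ptp Pti Ptnew] [f fs frad].
have Ptd := fingen_fdm onept_fdim Ptp.1.
have [v v0] : exists v : Pt, e0 *: v != 0.
  apply: contrapT => /forallNP e0v; apply: Ptnew.
  have Pt0 (x : Pt) : e0 *: x = 0.
    by apply/eqP; apply: contrapT => /negP; exact: e0v.
  have PtE := infl_corner Pt0.
  exists (corner Pt); split=> //; apply: proj_infl.
  exact: retract_proj (iso_retract (iso_sym PtE)) Ptp.
have [psi psiv] := simple0_functional Ptd v0.
have [p pE] : exists p : {linear A^o -> simple0}, forall a, p a = o_c a.
  exact: linear_ex.
have ps : surj p by move=> t; exists (Onept 0 0 t : A); rewrite pE.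
have [t tE] := Ptp.2 _ _ p psi ps.
have tc y : o_c (t y : A) = psi y by rewrite -pE tE.
have [s sE] : exists s : {linear A^o -> Pt}, forall a, s a = (a : A) *: (e0 *: v).
  apply: linear_ex => a x y; rewrite scalerDl; congr (_ + _).
  exact: esym (scalerA (a : A) (x : A) _).
have psie (a : A) : psi (a *: (e0 *: v)) = o_c a :> k.
  rewrite !linearZ psiv -[LHS]/(o_c a * (1 * 1)) !mulr1; by [].
have psist y : psi (s (t y)) = psi y by rewrite sE psie tc.
(* The endomorphism [s \o t] preserves psi, and psi v = 1, so it is not nilpotent. End Pt being
   local, it is bijective, and s is onto. *)
have gen y : exists a : A, y = a *: (e0 *: v).
  have [[h _ hK]|[n nil]] := local_end (s \o t) Ptd Pti.
    by exists (t (h y)); rewrite -sE; exact: esym (hK y).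
  have it j : psi (iter j (s \o t) v) = psi v.
    by elim: j => //= j <-; exact: psist.
  have := it n; rewrite nil linear0 psiv => /esym e1.
  by case/eqP: (oner_neq0 k).
pose W : {pred Pt} := [pred y | psi y == 0].
have Wc : submod_closed W.
  split=> [|a x y]; rewrite !inE ?linear0 // => /eqP Wx /eqP Wy.
  by rewrite linearP Wx Wy scaler0 addr0.
have full (V : {pred Pt}) y : submod_closed V -> y \in V -> psi y != 0 -> forall x, x \in V.
  move=> [V0 VD] Vy py x.
  have VZ (a : A) z : z \in V -> a *: z \in V by move=> Vz; rewrite -[_ *: _]addr0 VD.
  have [a ->] := gen x; apply: (VZ a).
  have [b yE] := gen y.
  have cb : o_c b != 0.
    by apply: contraNneq py => cb; rewrite yE; apply/eqP; rewrite psie cb.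
  (* Since y = b e0 v with [o_c b] nonzero, e0 y is a nonzero multiple of the generator. *)
  have -> : e0 *: v = ((o_c b)^-1 *: e0) *: y.
    have be : ((o_c b)^-1 *: e0) * b = e0.
      by rewrite -scalerAl e0_mul scalerA mulVf // scale1r.
    have ee : e0 * e0 = e0 by rewrite e0_mul -[o_c e0]/(1 : k) scale1r.
    by rewrite yE !scalerA mulrA be ee.
  exact: VZ.
have Wmax : maximal_sub W.
  split=> // [|V Vc WV].
    by exists v; rewrite inE psiv; exact: (oner_neq0 k).
  have [[y [Vy py]]|/forallNP Vpsi] := pselect (exists y, y \in V /\ psi y != 0).
    by left; exact: full Vc Vy py.
  right=> y Vy; rewrite inE; apply: contrapT => /negP py.
  by apply: (Vpsi y).
have fE y : f y = 0 <-> psi y = 0.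
  rewrite frad; split=> [/(_ W Wmax)|py V [Vc [x Vx] Vmax]]; first by rewrite inE => /eqP.
  have VW : {subset V <= W}.
    move=> z Vz; rewrite inE; apply: contrapT => /negP pz.
    by case/negP: Vx; exact: full Vc Vz pz x.
  have [WT|WV] := Vmax W Wc VW; last by apply: WV; rewrite inE py.
  have := WT v; rewrite inE psiv => /eqP e1.
  by case/eqP: (oner_neq0 k).
have psis : surj psi.
  move=> c; exists ((Onept 0 0 c : A) *: (e0 *: v)); exact: psie.
have [|g gE] := factor_surj (f := psi) fs; first by move=> y /fE.
have [|h hE] := factor_surj (f := f) psis; first by move=> y /fE.
apply/isoP; exists g, h; split=> z.
  by have [y <-] := fs z; rewrite gE hE.
by have [y <-] := psis z; rewrite hE gE.
Qed.

End OnePointExtension.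

(** * The mutation keeps S *)

Section Main.
Context (k : fieldType) (B : algType k) (P0 : lmodType B).
Notation A := (onept P0).
Notation S0 := (simple0 P0).

Lemma simple0_surj (X : lmodType A) (f : {linear X -> S0}) x : f x != 0 -> surj f.
Proof.
move=> fx c; exists ((Onept 0 0 ((c : k) / (f x : k)) : A) *: x).
by rewrite linearZ -[LHS]/((c : k) / (f x : k) * (f x : k)) divfK.
Qed.

Hypotheses (P0p : proj P0) (Bd : fdim (B : lmodType k)).
Let Ad : fdim (A : lmodType k) := onept_fdim P0p Bd.
Let S0d : fdm S0 := simple0_fdm P0p Bd.
Let S0i : indecomposable S0 := simple0_indec P0.

(** U kills S, whereas an f in E M killed by U is zero, f(u) being the value of u f at e_B. *)
Lemma calE_no_simple0 (M : lmodType B) : ~ retract S0 (calE P0 M).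
Proof.
move=> [i [p ip]]; have : i (one0 P0) = 0.
  apply: calE_ext => u.
  have <- : uhom ((Onept u.1 u.2 0 : A) *: i (one0 P0)) (one_u P0) = uhom (i (one0 P0)) u.
    by rewrite uhom_scale act_one.
  rewrite -linearZ -[X in i X]/((0 * 1 : k) : S0) mul0r -[X in i X]/0 linear0.
  by [].
by move=> /(congr1 p); rewrite ip linear0; apply/eqP; exact: (oner_neq0 k).
Qed.

(** Some indecomposable summand of X has a nonzero map to S, which is onto as S is simple; that
    summand belongs to T'. *)
Lemma simple0_Fac (T' X : lmodType A) : fdm X ->
  (forall Y, indecomposable Y -> retract Y X -> retract Y T') ->
  hom_nonzero X S0 -> Fac T' S0.
Proof.
move=> Xd XT; have := retract_refl X.
suff H Z : fdm Z -> retract Z X -> hom_nonzero Z S0 -> Fac T' S0 by exact: H.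
move: Z; apply: fdm_ind => [Z Z' ZZ' IH Z'X Z'S|Z Z0 _ [f [z fz]]|
  Z Zi ZX [f [z fz]]|Z Z' IH IH' ZX [f [z fz]]].
- apply: IH; first exact: retract_trans (iso_retract ZZ') Z'X.
  exact: hom_nonzero_iso (iso_sym ZZ') (iso_refl _) Z'S.
- by case: Z0; exists z; apply: contraNneq fz => ->; rewrite linear0.
- exact: Fac_surj (simple0_surj fz) (Fac_retract (XT Z Zi ZX)).
have [l lE] := inl_ex Z Z'; have [r rE] := inr_ex Z Z'.
case: z fz => x y; have -> : (x, y) = l x + r y by rewrite lE rE pairD addr0 add0r.
rewrite linearD => fxy.
have [fx|fx] := eqVneq (f (l x)) 0.
  apply: IH'; first exact: retract_trans (retract_prodr Z Z') ZX.
  by exists (f \o r), y; move: fxy; rewrite fx add0r.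
apply: IH; first exact: retract_trans (retract_prodl Z Z') ZX.
by exists (f \o l), x.
Qed.

(* If S0 were not a summand of T', the common almost complete pair would contain all
   of E M, so S0 would lie in Fac T' and (T' + S0, P') would be a tau-rigid pair
   with too many summands. *)
Lemma simple0_summand (T P T' P' : lmodType A) (M : lmodType B) :
  in_stau_tilt (T, P) -> in_stau_tilt (T', P') -> arrow (T, P) (T', P') ->
  iso T (calE P0 M * S0)%type -> hom_nonzero (calE P0 M) S0 ->
  retract S0 T'.
Proof.
move=> [[[[Tf _] Tt _] [m [p [Tm Pp Amp]]]] _].
move=> [[[[T'f P'p] T't PT'] [m' [p' [T'm P'p' Amp']]]] _].
move=> [[_ _ _ [[Z W] [[_ [a [b [Za Wb Aab]]]] _ [ZT WP] [ZT' _]]]] leT _] TM MS.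
rewrite /= in ZT WP ZT' Za Wb Tf Tt Tm Pp T'f P'p T't PT' T'm P'p'.
apply: contrapT => S0T'.
have Td := fingen_fdm Ad Tf; have T'd := fingen_fdm Ad T'f.
have /(tau_rigidP Ad Td) Tr := Tt; have /(tau_rigidP Ad T'd) T'r := T't.
have EMT : retract (calE P0 M) T.
  exact: retract_trans (retract_prodl _ S0) (iso_retract (iso_sym TM)).
have S0T : retract S0 T.
  exact: retract_trans (retract_prodr (calE P0 M) _) (iso_retract (iso_sym TM)).
have EMd := fdm_retract EMT Td.
have [n mn [X [XEM Xinj EMX]]] := card_ind_prod_inv EMd S0d S0i
  (@calE_no_simple0 M) (card_ind_iso TM Tm).
move/summandP: ZT' => ZT'; move/summandP: ZT => ZT.
have Zd := fdm_retract ZT Td.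
have [Y [YZ Yinj ZY]] := Za; have [V [VW Vinj WV]] := Wb; have [U [UP Uinj PU]] := Pp.
have [|s [sinj sE]] := match_exists (Y := X) Yinj.
  move=> i; have [Yi /summandP YiZ] := YZ i; apply: EMX => //; apply/summandP.
  have Yd := fdm_retract YiZ Zd.
  have YiT := retract_trans YiZ (retract_trans ZT (iso_retract TM)).
  have [//|YS] := indec_retract_prod Yd Yi YiT.
  case: S0T'; apply: retract_trans ZT'; apply: retract_trans YiZ.
  exact/iso_retract/iso_sym/(indec_retract_iso Yi.1 S0i YS).
have [|s' [s'inj _]] := match_exists (Y := U) Vinj.
  move=> i; have [Vi /summandP ViW] := VW i; apply: PU => //; apply/summandP.
  by apply: retract_trans ViW _; apply/summandP.
have bp : (b <= p)%N by have := leq_card s' s'inj; rewrite !card_ord.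
(* From a + b + 1 = m + p and m = n + 1 follows a + b = n + p, and b <= p. So the injection s from
   the summands of Z to those of E M is onto. *)
have an : (n <= a)%N.
  have := card_ind_uniq Aab Amp; rewrite mn addSn => -[e].
  by rewrite -(leq_add2r p) -e leq_add2l.
have S0F : Fac T' S0.
  apply: simple0_Fac EMd _ MS => K Ki /summandP KEM.
  have [i Ki'] := EMX K Ki KEM.
  have [j ij] : exists j, i = s j.
    have /(inj_card_onto sinj)/(_ i)/codomP : (#|'I_n| <= #|'I_a|)%N by rewrite !card_ord.
    by [].
  apply: retract_trans ZT'.
  have [_ /summandP] := YZ j; apply: retract_trans.
  by apply: iso_retract; apply: iso_trans Ki' _; rewrite ij; exact: iso_sym.
(* T' + S stays inside Fac T', so Ext^1(T', -) vanishes on its factors by the rigidity of T', and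
   Ext^1(S, -) by that of T. *)
have T'SF : Fac T' (T' * S0)%type := Fac_prod (Fac_refl T') S0F.
have S0r : relproj S0 (T' * S0)%type.
  apply: relproj_Fac T'SF _; apply: relproj_Fac (leT _ (Fac_refl T')) _.
  exact: retract_relproj S0T Tr.
have T'Sr := relproj_prod (relproj_Fac T'SF T'r) S0r.
have := rigid_bound Ad (fdm_prod T'd S0d).1 T'Sr P'p _
  (card_ind_prodS T'd S0d S0i S0T' T'm) P'p' Amp'.
rewrite addSn ltnn => bound; suff : false by []; apply: bound => hP'.
exact/PT'/(hom_nonzero_Fac P'p.2 T'SF hP').
Qed.

Lemma corner_fdm (X : lmodType A) : fdm X -> fdm (corner X).
Proof.
have [f fE] : exists f : {linear kmod (corner X) -> kmod X}, forall z, f z = val z.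
  apply: (@linear_ex k (kmod (corner X)) (kmod X)) => c y z.
  rewrite val_cornerD; congr (_ + _); exact: (val_corner_scale (c%:A : A)).
by apply: (fdim_sub (f := f)) => x y; rewrite !fE => /val_inj.
Qed.

End Main.

Theorem theorem3p4 (k : closedFieldType) (B : falgType k)
    (hBbasic : basic_alg B) (hBconn : connected_alg B)
    (P0 : lmodType B) (hP0 : proj P0)
    (Pt S : lmodType (onept P0))
    (hPt : new_projective Pt) (hS : is_top Pt S)
    (T P T' P' : lmodType (onept P0))
    (hTP : in_stau_tilt (T, P)) (hTP' : in_stau_tilt (T', P'))
    (harrow : arrow (T, P) (T', P'))
    (M Q : lmodType B) (hMQ : in_stau_tilt (M, Q))
    (he : pair_iso (T, P) (emap S (M, Q)))
    (hHom : hom_nonzero (calE P0 M) S) :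
  exists N R : lmodType B,
    in_stau_tilt (N, R) /\ pair_iso (T', P') (emap S (N, R)).
Proof.
have Bd := falg_fdim B; have Ad := onept_fdim hP0 Bd.
have S0d := simple0_fdm hP0 Bd; have S0i := simple0_indec P0.
have SS0 := new_projective_top hP0 Bd hPt hS.
move: he => [/= TMS PQ].
have TM : iso T (calE P0 M * simple0 P0)%type.
  exact: iso_trans TMS (iso_prod (iso_refl _) SS0).
have MS := hom_nonzero_iso (iso_refl _) SS0 hHom.
have S0T' := simple0_summand hP0 Bd hTP hTP' harrow TM MS.
have FT'T : Fac T T' by have [_ leT _] := harrow; exact: leT (Fac_refl T').
have [[[[/= Tf _] Tt _] [m [p [/= Tm Pp Amp]]]] [/= Tb _]] := hTP.
have [[[[/= T'f P'p] T't PT'] [m' [p' [/= T'm P'p' Amp']]]] [/= T'b P'b]] := hTP'.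
have [[_ [m1 [q1 [/= Mm1 Qq1 Bmq]]]] _] := hMQ.
have Td := fingen_fdm Ad Tf; have T'd := fingen_fdm Ad T'f.
have /(tau_rigidP Ad T'd) T'r := T't.
have [i [j ij]] := S0T'.
have [Y [l [_ _ T'SY]]] := retract_split ij.
have YT' : retract Y T'.
  exact: retract_trans (retract_prodr (simple0 P0) _) (iso_retract (iso_sym T'SY)).
have Yd := fdm_retract YT' T'd.
(* A second copy of S would make S + S a summand of the basic module T'. *)
have S0Y : ~ retract (simple0 P0) Y.
  move=> SY; apply: (T'b _ S0i); apply/summandP.
  apply: retract_trans (iso_retract (iso_sym T'SY)).
  apply: retract_trans (iso_retract (iso_prodC _ _)).
  exact: retract_prod.
(* Ext^1(S, Y) = 0 because S and Y are both summands of the rigid module T'. *)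
have YE : iso Y (calE P0 (corner Y)).
  apply: iso_calE_corner => //.
  by apply: retract_relproj S0T' (relproj_Fac (Fac_retract YT') T'r).
(* A nonzero element of e0 P' would give a nonzero map P' -> S, and S is a summand of T'. *)
have P'R : iso P' (infl P0 (corner P')).
  apply: infl_corner => x; apply/eqP; apply: contrapT => /negP x0.
  have [f fx] := simple0_functional (fingen_fdm Ad P'p.1) x0.
  apply: PT'; exists (i \o f), x; rewrite /= fx.
  apply/eqP => /(congr1 j); rewrite ij linear0.
  by apply/eqP; exact: (oner_neq0 k).
have T'E : iso T' (calE P0 (corner Y) * simple0 P0)%type.
  apply: iso_trans T'SY _; apply: iso_trans (iso_prodC _ _) _.
  exact: iso_prod YE (iso_refl _).
have ET' : retract (calE P0 (corner Y)) T'.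
  exact: retract_trans (iso_retract (iso_sym YE)) YT'.
have Nd := corner_fdm Yd.
have ENd := fdm_retract ET' T'd.
have EMd : fdm (calE P0 M).
  apply: fdm_retract Td; apply: retract_trans (iso_retract (iso_sym TM)).
  exact: retract_prodl.
exists (corner Y), (corner P'); split; last first.
  split=> //=; apply: iso_trans T'E _.
  exact: iso_prod (iso_refl _) (iso_sym SS0).
split; last first.
  split=> /=; first exact/calE_basic/(retract_basic ET').
  exact/infl_basic/(retract_basic (iso_retract (iso_sym P'R))).
split.
  split=> /=.
  - split; first exact: fdm_fingen.
    exact/proj_infl/(retract_proj (iso_retract (iso_sym P'R))).
  - apply/(tau_rigidP Bd Nd)/(relproj_calE hP0).
    exact: retract_relproj ET' (relproj_Fac (Fac_retract ET') T'r).
  move=> /(hom_infl_calE P0) hRN; apply: PT'.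
  have [g [x gx]] := hom_nonzero_iso (iso_sym P'R) (iso_refl _) hRN.
  have [e [f ef]] := ET'; exists (e \o g), x.
  by apply: contraNneq gx => /= /(congr1 f); rewrite ef linear0 => ->.
have [n' m'n' ENn'] := card_ind_prod_inv ENd S0d S0i (@calE_no_simple0 _ _ P0 (corner Y))
  (card_ind_iso T'E T'm).
have [n mn EMn] := card_ind_prod_inv EMd S0d S0i (@calE_no_simple0 _ _ P0 M)
  (card_ind_iso TM Tm).
(* The count over B: |N| + |R| = |T'| - 1 + |P'| = |T| - 1 + |P| = |M| + |Q| = |B|. *)
have e1 := card_ind_uniq (calE_card EMn) Mm1.
have e2 := card_ind_uniq (infl_card (card_ind_iso PQ Pp)) Qq1.
exists n', p'; split=> /=.
- exact: calE_card ENn'.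
- exact/infl_card/(card_ind_iso P'R).
have := card_ind_uniq Amp Amp'; rewrite mn m'n' !addSn => -[<-].
by rewrite e1 e2.
Qed.
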